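(* Let $p\ge1$, $L\ge2$, $\lambda_1,\lambda_2\ge0$, and let $S=(S^{(1)},\dots,S^{(L)})$ be a tuple of symmetric positive semidefinite $p\times p$ matrices. Consider the fused graphical Lasso problem $$(\mathrm{P})\quad\min_{\Theta,\Omega}\Big\{f(\Theta,\Omega):=\sum_{l=1}^L\big(\vartheta(\Omega^{(l)})+\langle S^{(l)},\Theta^{(l)}\rangle\big)+\mathcal{P}(\Theta)\ \Big|\ \Theta-\Omega=0\Big\}$$ and its dual $$(\mathrm{D})\quad\max_X\ \sum_{l=1}^L\big(-\vartheta(X^{(l)})+p\big)-\mathcal{P}^*(X-S).$$ Assume the KKT system of (P) (see context) has a solution; it is then unique and denoted $(\overline{\Theta},\overline{\Omega},\overline{X})$. Let $\{(\Theta^k,\Omega^k,X^k)\}$ be an infinite sequence generated by the regularized proximal point algorithm (rPPA) described in the context under stopping criterion (A). Then $\{(\Theta^k,\Omega^k)\}$ converges to the unique solution $(\overline{\Theta},\overline{\Omega})$ of (P), and $\{X^k\}$ converges to the unique solution $\overline{X}$ of (D). Furthermore, if criterion (B) is also executed in the algorithm, then there exists $\bar{k}\ge0$ such that for all $k\ge\bar{k}$, $$\|(\Theta^{k+1},\Omega^{k+1},X^{k+1})-(\overline{\Theta},\overline{\Omega},\overline{X})\|\le\mu_k\|(\Theta^k,\Omega^k,X^k)-(\overline{\Theta},\overline{\Omega},\overline{X})\|,$$ where $$1>\mu_k:=\frac{\kappa(\kappa^2+\sigma_k^2)^{-1/2}+\delta_k}{1-\delta_k}\ \longrightarrow\ \mu_\infty=\kappa(\kappa^2+\sigma_\infty^2)^{-1/2}\quad(\mu_\infty=0\text{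 if }\sigma_\infty=\infty),$$ and $\kappa\ge0$ is a constant for which there is $\varrho>0$ such that $\|(\Theta,\Omega,X)-(\overline{\Theta},\overline{\Omega},\overline{X})\|\le\kappa\|\Delta\|$ for all $(\Theta,\Omega,X)$ and all $\Delta\in\mathcal{T}_{\mathcal{L}}(\Theta,\Omega,X)$ with $\|\Delta\|\le\varrho$ (such a $\kappa$ exists).
   Context: $\mathbb{S}^p$ is the space of real symmetric $p\times p$ matrices, $\mathbb{S}^p_+$ and $\mathbb{S}^p_{++}$ the sets of positive semidefinite and positive definite ones. $\mathcal{Y}=\mathbb{S}^p\times\cdots\times\mathbb{S}^p$ and $\mathcal{X}=\mathbb{S}^p_+\times\cdots\times\mathbb{S}^p_+$ ($L$ copies each), with the product of trace inner products and induced (Frobenius) norms. $\vartheta(A)=-\log\det A$ if $A\in\mathbb{S}^p_{++}$ and $+\infty$ otherwise. $\mathcal{P}$ is the fused graphical Lasso regularizer $$\mathcal{P}(\Theta)=\lambda_1\sum_{l=1}^L\sum_{i\ne j}|\Theta^{(l)}_{ij}|+\lambda_2\sum_{l=2}^L\sum_{i\ne j}|\Theta^{(l)}_{ij}-\Theta^{(l-1)}_{ij}|,$$ and $\mathcal{P}^*$ is its convex conjugate. $\mathrm{Prox}_g(u)=\arg\min_{u'}\{g(u')+\frac12\|u'-u\|^2\}$. KKT system of (P): $\Theta-\mathrm{Prox}_{\mathcal{P}}(\Theta+X-S)=0$; $\Omega^{(l)}-\mathrm{Prox}_\vartheta(\Omega^{(l)}-X^{(l)})=0$ for $l=1,\dots,L$;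 $\Theta-\Omega=0$. Lagrangian: $\mathcal{L}(\Theta,\Omega,X)=f(\Theta,\Omega)-\langle\Theta-\Omega,X\rangle$. The operator $\mathcal{T}_{\mathcal{L}}(\Theta,\Omega,X)=\{(\Theta',\Omega',X'):(\Theta',\Omega',-X')\in\partial\mathcal{L}(\Theta,\Omega,X)\}$; explicitly, $(\Theta',\Omega',X')\in\mathcal{T}_{\mathcal{L}}(\Theta,\Omega,X)$ iff $\Theta'\in S+\partial\mathcal{P}(\Theta)-X$, $\Omega'^{(l)}\in\partial\vartheta(\Omega^{(l)})+X^{(l)}$ for all $l$, and $X'=\Theta-\Omega$. Algorithm rPPA: let $\{\sigma_k\}$ be a sequence of positive scalars with $\sigma_k\uparrow\sigma_\infty\le\infty$. Choose $\Theta^0,\Omega^0\in\mathcal{X}$ and $X^0\in\mathcal{Y}$. For $k=0,1,2,\dots$: Step 1. Compute $X^{k+1}\approx\arg\max_X\{\widehat{\Phi}_k(X):=\Phi_k(X)-\frac{1}{2\sigma_k}\|X-X^k\|^2\}$, where $$\Phi_k(X):=\inf_{\Theta,\Omega}\Big\{\mathcal{L}(\Theta,\Omega,X)+\frac{1}{2\sigma_k}\big(\|\Theta-\Theta^k\|^2+\|\Omega-\Omega^k\|^2\big)\Big\}$$ (this function is concave and continuously differentiable on $\mathcal{Y}$). Step 2. Set $\Theta^{k+1}=\mathrm{Prox}_{\sigma_k\mathcal{P}}(\Theta^k+\sigma_k(X^{k+1}-S))$ and $(\Omega^{(l)})^{k+1}=\mathrm{Prox}_{\sigma_k\vartheta}((\Omega^{(l)})^k-\sigma_k(X^{(l)})^{k+1})$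 for $l=1,\dots,L$. Stopping criteria for the inexact computation in Step 1 (to hold for every $k$): (A) $\|\nabla\widehat{\Phi}_k(X^{k+1})\|\le\varepsilon_k/\sigma_k$, where $\varepsilon_k\ge0$, $\sum_{k=0}^\infty\varepsilon_k<\infty$; (B) $\|\nabla\widehat{\Phi}_k(X^{k+1})\|\le(\delta_k/\sigma_k)\|(\Theta^{k+1},\Omega^{k+1})-(\Theta^k,\Omega^k)\|$, where $\delta_k\ge0$, $\sum_{k=0}^\infty\delta_k<\infty$. *)

(* Defs.v *)
From HB Require Import structures.
From mathcomp Require Import all_boot all_order all_algebra.
From mathcomp Require Import all_classical all_reals all_analysis.
From mathcomp Require Import lra.

Set Implicit Arguments.
Unset Strict Implicit.
Unset Printing Implicit Defensive.

Import Order.TTheory GRing.Theory Num.Theory.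
Import numFieldNormedType.Exports.

Local Open Scope classical_set_scope.
Local Open Scope ring_scope.

HB.mixin Record Lmodule_isInner (R : realType) V of GRing.Lmodule R V := {
  dot : V -> V -> R ;
  dotC : forall u v, dot u v = dot v u ;
  dotDl : forall u v w, dot (u + v) w = dot u w + dot v w ;
  dotZl : forall a u v, dot (a *: u) v = a * dot u v ;
  dot_ge0 : forall u, 0 <= dot u u ;
  dot_eq0 : forall u, dot u u = 0 -> u = 0 }.

#[short(type="innerType")]
HB.structure Definition Inner (R : realType) :=
  { V of GRing.Lmodule R V & Lmodule_isInner R V }.

Definition enorm (R : realType) (V : innerType R) (v : V) : R :=
  Num.sqrt (dot v v).

Section InnerInstances.
Context (R : realType).

Section Prod.
Context (V W : innerType R).
Definition prod_dot (u v : V * W) : R := dot u.1 v.1 + dot u.2 v.2.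
Fact prod_dotC u v : prod_dot u v = prod_dot v u.
Proof. by rewrite /prod_dot dotC [dot u.2 _]dotC. Qed.
Fact prod_dotDl u v w : prod_dot (u + v) w = prod_dot u w + prod_dot v w.
Proof. by rewrite /prod_dot !dotDl addrACA. Qed.
Fact prod_dotZl a u v : prod_dot (a *: u) v = a * prod_dot u v.
Proof. by rewrite /prod_dot !dotZl mulrDr. Qed.
Fact prod_dot_ge0 u : 0 <= prod_dot u u.
Proof. by rewrite addr_ge0 ?dot_ge0. Qed.
Fact prod_dot_eq0 u : prod_dot u u = 0 -> u = 0.
Proof.
case: u => a b /eqP; rewrite /prod_dot /= paddr_eq0 ?dot_ge0 //.
by case/andP => /eqP/dot_eq0 -> /eqP/dot_eq0 ->.
Qed.
HB.instance Definition _ := Lmodule_isInner.Build R (V * W)%type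
  prod_dotC prod_dotDl prod_dotZl prod_dot_ge0 prod_dot_eq0.
End Prod.

Section Ffun.
Context (I : finType) (V : innerType R).
Definition ffun_dot (u v : {ffun I -> V}) : R := \sum_i dot (u i) (v i).
Fact ffun_dotC u v : ffun_dot u v = ffun_dot v u.
Proof. by apply: eq_bigr => i _; rewrite dotC. Qed.
Fact ffun_dotDl u v w : ffun_dot (u + v) w = ffun_dot u w + ffun_dot v w.
Proof. by rewrite -big_split; apply: eq_bigr => i _; rewrite ffunE dotDl. Qed.
Fact ffun_dotZl a u v : ffun_dot (a *: u) v = a * ffun_dot u v.
Proof. by rewrite mulr_sumr; apply: eq_bigr => i _; rewrite ffunE dotZl. Qed.
Fact ffun_dot_ge0 u : 0 <= ffun_dot u u.
Proof. by apply: sumr_ge0 => i _; exact: dot_ge0. Qed.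
Fact ffun_dot_eq0 u : ffun_dot u u = 0 -> u = 0.
Proof.
move=> /eqP; rewrite psumr_eq0 => [/allP u0|i _]; last exact: dot_ge0.
apply/ffunP => i; rewrite ffunE; apply: dot_eq0; apply/eqP.
exact: u0 (mem_index_enum i).
Qed.
HB.instance Definition _ := Lmodule_isInner.Build R {ffun I -> V}
  ffun_dotC ffun_dotDl ffun_dotZl ffun_dot_ge0 ffun_dot_eq0.
End Ffun.

Section Sym.
Context (p : nat).

Definition symmx_pred : {pred 'M[R]_p} := [pred A | A^T == A].
Fact symmx_submod : submod_closed symmx_pred.
Proof.
split=> [|a A B]; rewrite !inE ?trmx0 // => /eqP AT /eqP BT.
by rewrite linearP /= AT BT.
Qed.
HB.instance Definition _ := GRing.isSubmodClosed.Build R 'M[R]_p symmx_pred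
  symmx_submod.

Record symmx := SymMx { symmx_val :> 'M[R]_p ; _ : symmx_val \in symmx_pred }.
HB.instance Definition _ := [isSub for symmx_val].
HB.instance Definition _ := [Choice of symmx by <:].
HB.instance Definition _ := [SubChoice_isSubZmodule of symmx by <:].
HB.instance Definition _ := [SubZmodule_isSubLmodule of symmx by <:].

Definition symmx_dot (A B : symmx) : R := \tr (symmx_val A *m symmx_val B).
Fact symmx_dotC A B : symmx_dot A B = symmx_dot B A.
Proof. exact: mxtrace_mulC. Qed.
Fact symmx_dotDl A B C : symmx_dot (A + B) C = symmx_dot A C + symmx_dot B C.
Proof. by rewrite /symmx_dot -[symmx_val]/val raddfD /= mulmxDl mxtraceD. Qed.
Fact symmx_dotZl a A B : symmx_dot (a *: A) B = a * symmx_dot A B.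
Proof. by rewrite /symmx_dot -[symmx_val]/val linearZ /= -scalemxAl mxtraceZ. Qed.
Fact symmx_dotE A : symmx_dot A A = \sum_i \sum_j A i j ^+ 2.
Proof.
case: A => A AT; rewrite /symmx_dot /=; apply: eq_bigr => i _.
rewrite mxE; apply: eq_bigr => j _; move: AT; rewrite inE => /eqP AT.
by rewrite -[in A j i]AT mxE expr2.
Qed.
Fact symmx_dot_ge0 A : 0 <= symmx_dot A A.
Proof.
by rewrite symmx_dotE; do 2!apply: sumr_ge0 => ? _; exact: sqr_ge0.
Qed.
Fact symmx_dot_eq0 A : symmx_dot A A = 0 -> A = 0.
Proof.
rewrite symmx_dotE => /eqP; rewrite psumr_eq0 => [/allP A0|i _]; last first.
  by apply: sumr_ge0 => ? _; exact: sqr_ge0.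
apply/val_inj/matrixP => i j /=; rewrite mxE.
have := A0 i (mem_index_enum i); rewrite /= psumr_eq0 => [/allP Ai0|? _]; last first.
  exact: sqr_ge0.
by have := Ai0 j (mem_index_enum j); rewrite /= sqrf_eq0 => /eqP.
Qed.
HB.instance Definition _ := Lmodule_isInner.Build R symmx
  symmx_dotC symmx_dotDl symmx_dotZl symmx_dot_ge0 symmx_dot_eq0.

End Sym.
End InnerInstances.

Notation "''S[' R ]_ p" := (symmx R p)
  (at level 0, p at level 2, format "''S[' R ]_ p").
Notation "''Y[' R ]_( L , p )" := {ffun 'I_L -> 'S[R]_p}
  (at level 0, format "''Y[' R ]_( L ,  p )").

Section ConvexAnalysis.
Context (R : realType) (V : innerType R).
Implicit Types (g : V -> \bar R) (u v x : V).
Local Open Scope ereal_scope.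

Definition argmin_on (T : Type) (D : set T) (F : T -> \bar R) : set T :=
  [set v | D v /\ forall w, D w -> F v <= F w].

Definition argmax_on (T : Type) (D : set T) (F : T -> \bar R) : set T :=
  [set v | D v /\ forall w, D w -> F w <= F v].

(* [is_prox g u v] is the graph of Prox_g: v = Prox_g(u). *)
Definition is_prox g u v : Prop :=
  argmin_on setT (fun u' => g u' + (2^-1 * enorm (u' - u) ^+ 2)%:E) v.

Definition subdifferential g x : set V :=
  [set v | forall y, g x + (dot v (y - x))%:E <= g y].

Definition conjugate g v : \bar R :=
  ereal_sup (range (fun x => (dot v x)%:E - g x)).

(* G is the gradient of g at x, in the sense of Frechet; the inequality forces
   g to be finite at x and near x. *)
Definition is_gradient g x (G : V) : Prop :=
  forall e : R, (0 < e)%R -> exists2 d : R, (0 < d)%R &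
    forall h : V, (enorm h <= d)%R ->
      `|g (x + h)%R - g x - (dot G h)%:E| <= (e * enorm h)%:E.

Definition gradient_norm_le g x (c : R) : Prop :=
  exists2 G, is_gradient g x G & (enorm G <= c)%R.

End ConvexAnalysis.

Section FusedGraphicalLasso.
Context (R : realType) (p L : nat) (lambda1 lambda2 : R).
Local Notation Sp := 'S[R]_p.
Local Notation Y := 'Y[R]_(L, p).

Definition psdmx (A : Sp) : Prop :=
  forall x : 'rV[R]_p, 0 <= (x *m A *m x^T) 0 0.

Definition pdmx (A : Sp) : Prop :=
  forall x : 'rV[R]_p, x != 0 -> 0 < (x *m A *m x^T) 0 0.

Definition vartheta (A : Sp) : \bar R :=
  if `[< pdmx A >] then (- ln (\det A))%:E else +oo%E.

(* Indices run over 0, ..., L - 1, so the fused terms are the pairs of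
   consecutive indices (m, l) with l = m + 1. *)
Definition fused_reg (Theta : Y) : R :=
  lambda1 * (\sum_(l < L) \sum_(i < p) \sum_(j < p | i != j) `|Theta l i j|)
  + lambda2 * (\sum_(l < L) \sum_(m < L | l == m.+1 :> nat)
      \sum_(i < p) \sum_(j < p | i != j) `|Theta l i j - Theta m i j|).

Definition fused_regE (Theta : Y) : \bar R := (fused_reg Theta)%:E.

Variable S : Y.

Definition primal_obj (Theta Omega : Y) : \bar R :=
  (\sum_(l < L) (vartheta (Omega l) + (dot (S l) (Theta l))%:E)
   + fused_regE Theta)%E.

Definition primal_solutions : set (Y * Y) :=
  argmin_on [set z | z.1 - z.2 = 0] (fun z => primal_obj z.1 z.2).

Definition dual_obj (X : Y) : \bar R :=
  (\sum_(l < L) (- vartheta (X l) + p%:R%:E)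
   - conjugate fused_regE (X - S)%R)%E.

Definition dual_solutions : set Y := argmax_on setT dual_obj.

Definition KKT : set (Y * Y * Y) := [set z : Y * Y * Y |
  let: (Theta, Omega, X) := z in
  [/\ is_prox fused_regE (Theta + X - S) Theta,
      forall l, is_prox vartheta (Omega l - X l) (Omega l)
    & Theta - Omega = 0]].

Definition lagrangian (Theta Omega X : Y) : \bar R :=
  (primal_obj Theta Omega - (dot (Theta - Omega) X)%:E)%E.

(* Subdifferential of a convex-concave function: a subgradient in
   (Theta, Omega), and a supergradient in X. *)
Definition lagrangian_subdiff (z : Y * Y * Y) : set (Y * Y * Y) :=
  [set w : Y * Y * Y |
  let: (Theta, Omega, X) := z in let: (T, U, W) := w in
  (forall Theta' Omega', lagrangian Theta Omega X
     + (dot T (Theta' - Theta)%R + dot U (Omega' - Omega)%R)%:E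
     <= lagrangian Theta' Omega' X)%E
  /\ (forall X', lagrangian Theta Omega X'
     <= lagrangian Theta Omega X + (dot W (X' - X)%R)%:E)%E].

Definition T_lagrangian (z : Y * Y * Y) : set (Y * Y * Y) :=
  [set D : Y * Y * Y |
    let: (T, U, W) := D in lagrangian_subdiff z (T, U, - W)].

Definition error_bound (zbar : Y * Y * Y) (kappa : R) : Prop :=
  exists2 rho : R, 0 < rho &
    forall z D, T_lagrangian z D -> enorm D <= rho ->
      enorm (z - zbar) <= kappa * enorm D.

Section Algorithm.
Variables (sigma : nat -> R) (Theta Omega X : nat -> Y).

Definition Phi (k : nat) (Z : Y) : \bar R :=
  ereal_inf (range (fun z : Y * Y => lagrangian z.1 z.2 Z
    + ((2 * sigma k)^-1 *
        (enorm (z.1 - Theta k)%R ^+ 2 + enorm (z.2 - Omega k)%R ^+ 2))%:E)%E).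

Definition Phi_hat (k : nat) (Z : Y) : \bar R :=
  (Phi k Z - ((2 * sigma k)^-1 * enorm (Z - X k)%R ^+ 2)%:E)%E.

(* The inexactness of Step 1 is carried by [critA] and [critB]; besides these
   the multiplier X k.+1 is arbitrary. *)
Record rPPA : Prop := {
  rPPA_Theta0 : forall l, psdmx (Theta 0 l) ;
  rPPA_Omega0 : forall l, psdmx (Omega 0 l) ;
  rPPA_Theta : forall k,
    is_prox (fun T => (sigma k)%:E * fused_regE T)%E
      (Theta k + sigma k *: (X k.+1 - S)) (Theta k.+1) ;
  rPPA_Omega : forall k l,
    is_prox (fun U => (sigma k)%:E * vartheta U)%E
      (Omega k l - sigma k *: X k.+1 l) (Omega k.+1 l) }.

Definition critA (eps : nat -> R) : Prop :=
  [/\ forall k, 0 <= eps k, cvgn (series eps)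
    & forall k, gradient_norm_le (Phi_hat k) (X k.+1) (eps k / sigma k)].

Definition critB (delta : nat -> R) : Prop :=
  [/\ forall k, 0 <= delta k, cvgn (series delta)
    & forall k, gradient_norm_le (Phi_hat k) (X k.+1)
        (delta k / sigma k
         * enorm ((Theta k.+1, Omega k.+1) - (Theta k, Omega k)))].

End Algorithm.
End FusedGraphicalLasso.

Section Dot.
Context (R : realType) (V : innerType R).
Implicit Types u v w : V.
Lemma dotDr u v w : dot u (v + w) = dot u v + dot u w.
Proof. by rewrite dotC dotDl !(dotC u). Qed.
Lemma dotNl u v : dot (- u) v = - dot u v.
Proof. by rewrite -scaleN1r dotZl mulN1r. Qed.
Lemma dotNr u v : dot u (- v) = - dot u v.
Proof. by rewrite dotC dotNl dotC. Qed.
Lemma dot0r u : dot u 0 = 0.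
Proof. by have := dotNr u 0; rewrite oppr0; lra. Qed.
End Dot.
Local Notation dotE := (dotDl, dotDr, dotNl, dotNr).

Section ExplicitOperator.
Context (R : realType) (p L : nat) (lambda1 lambda2 : R).
Local Notation Y := 'Y[R]_(L, p).
Variable S : Y.
Local Notation P := (fused_reg lambda1 lambda2).
Let h (Om : Y) : \bar R := (\sum_(l < L) vartheta (Om l))%E.

Lemma lagrE (Th Om X : Y) : lagrangian lambda1 lambda2 S Th Om X =
  (h Om + (dot S Th + P Th - dot (Th - Om) X)%:E)%E.
Proof.
rewrite /lagrangian /primal_obj big_split /= sumEFin /fused_regE /h.
by rewrite -!addeA -!EFinD addrA.
Qed.

Lemma symmx1_subproof : (1%:M : 'M[R]_p) \in @symmx_pred R p.
Proof. by rewrite inE trmx1. Qed.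
Let I1 : symmx R p := SymMx symmx1_subproof.
Lemma pd1 : pdmx I1.
Proof.
move=> x x0 /=; rewrite mulmx1 mxE lt_neqAle; apply/andP; split; last first.
  by apply: sumr_ge0 => i _; rewrite mxE -expr2 sqr_ge0.
rewrite eq_sym; apply: contra x0 => /eqP; under eq_bigr do rewrite mxE -expr2.
move/eqP; rewrite psumr_eq0 => [/allP H|? _]; last exact: sqr_ge0.
apply/eqP/matrixP => i j; rewrite ord1 mxE; apply/eqP.
by have := H j (mem_index_enum j); rewrite /= sqrf_eq0.
Qed.

Lemma var_gtN A : (-oo < @vartheta R p A)%E.
Proof. by rewrite /vartheta; case: ifP; rewrite ?ltNyr ?ltNy0. Qed.
Lemma h_gtN Om : (-oo < h Om)%E.
Proof. rewrite lteNye; apply/eqP => /esum_eqNyP[l [_ _ E]].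
by have := var_gtN (Om l); rewrite E ltxx. Qed.

Lemma T_lagrangianP (Th Om X T U W : Y) :
  T_lagrangian lambda1 lambda2 S (Th, Om, X) (T, U, W) <->
  [/\ subdifferential (fused_regE lambda1 lambda2) Th (T + X - S),
      forall l, subdifferential (@vartheta R p) (Om l) (U l - X l)
    & W = Th - Om].
Proof.
rewrite /T_lagrangian /lagrangian_subdiff /=; split.
- move=> [H1 H2].
  have finh : h Om \is a fin_num.
    rewrite fin_numElt h_gtN /=.
    have := H1 Th [ffun=> I1]; rewrite !lagrE.
    have -> : h [ffun=> I1] = (\sum_(l < L) (- ln (\det (symmx_val I1)))%:E)%E.
      by apply: eq_bigr => l _; rewrite ffunE /vartheta asboolT //; exact: pd1.
    rewrite sumEFin -EFinD -addeA -EFinD.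
    by case: (h Om) => [r| |] //=; rewrite ?ltry // addye // leye_eq.
  have [a ha] : exists a, h Om = a%:E by exists (fine (h Om)); rewrite (fineK finh).
  split.
  + move=> Th'; rewrite -EFinD lee_fin.
    have := H1 Th' Om; rewrite !lagrE ha -!EFinD lee_fin.
    by rewrite !dotE ?(dotC Th X) ?(dotC Th' X) ?(dotC Om X); lra.
  + move=> l A.
    have := H1 Th [ffun m => if m == l then A else Om m]; rewrite !lagrE ha.
    have hs : (h Om = vartheta (Om l) + \sum_(m < L | m != l) vartheta (Om m))%E.
      by rewrite /h (bigD1 l).
    have -> : (h [ffun m => if m == l then A else Om m] =
       vartheta A + \sum_(m < L | m != l) vartheta (Om m))%E.
      rewrite /h (bigD1 l) //= ffunE eqxx; congr adde.
      by apply: eq_bigr => m /negbTE ml; rewrite ffunE ml.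
    have dd Z : dot Z ([ffun m => if m == l then A else Om m] - Om) = dot (Z l) (A - Om l).
      rewrite /dot/= /ffun_dot (bigD1 l) //= !ffunE eqxx big1 ?addr0 // => m /negbTE ml.
      by rewrite !ffunE ml subrr dot0r.
    have eX : dot (Th - [ffun m => if m == l then A else Om m]) X = dot (Th - Om) X - dot (X l) (A - Om l).
      by rewrite -dd !dotE ?(dotC _ X); lra.
    rewrite eX dd subrr dot0r.
    rewrite ha in hs; move: hs.
    case: (vartheta (Om l)) (var_gtN (Om l)) => [b| |]; rewrite ?ltxx // => _.
      case: (\sum_(m < L | m != l) _)%E => [c| |] //=.
      rewrite -EFinD => -[->].
      case: (vartheta A) (var_gtN A) => [d| |]; rewrite ?ltxx // => _; last first.
        by rewrite !addye ?leey.
      by rewrite -!EFinD !lee_fin !dotE; lra.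
    move=> E; exfalso; move: E.
    have : (\sum_(m < L | m != l) vartheta (Om m) != -oo)%E.
      apply/eqP => /esum_eqNyP[m [_ _ E]].
      by have := var_gtN (Om m); rewrite E ltxx.
    by case: (\sum_(m < L | m != l) _)%E.
  + apply/eqP; rewrite -subr_eq0; apply/eqP/dot_eq0.
    have := H2 (X + (W - (Th - Om))); rewrite !lagrE ha -!EFinD lee_fin.
    have : 0 <= dot (W - (Th - Om)) (W - (Th - Om)) by exact: dot_ge0.
    by rewrite !dotE ?(dotC W X) ?(dotC Th X) ?(dotC Om X) ?(dotC Th W) ?(dotC Om W) ?(dotC Om Th); lra.
- move=> [H1 H2 ->]; split.
  + move=> Th' Om'; rewrite !lagrE.
    have K2 : (h Om + (dot (U - X) (Om' - Om))%:E <= h Om')%E.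
      rewrite /dot/= /ffun_dot -sumEFin -big_split /=; apply: lee_sum => l _.
      by have := H2 l (Om' l); rewrite !ffunE.
    have := H1 Th'; rewrite -EFinD lee_fin => K1.
    apply: (@le_trans _ _ (h Om + (dot (U - X) (Om' - Om))%:E
      + (dot S Th' + P Th' - dot (Th' - Om') X)%:E)%E); last exact: leeD.
    rewrite -!addeA leeD2l // -!EFinD lee_fin.
    move: K1; rewrite !dotE ?(dotC Th X) ?(dotC Th' X) ?(dotC Om X) ?(dotC Om' X).
    by lra.
  + move=> X'; rewrite !lagrE -addeA leeD2l // -EFinD lee_fin.
    by rewrite !dotE ?(dotC Th X) ?(dotC Om X); lra.
Qed.
End ExplicitOperator.

Definition rate (R : realType) (kappa sigma delta : R) : R :=
  (kappa * (Num.sqrt (kappa ^+ 2 + sigma ^+ 2))^-1 + delta) / (1 - delta).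

Definition rate_limit (R : realType) (kappa : R) (sigma : \bar R) : R :=
  if sigma is s%:E then kappa * (Num.sqrt (kappa ^+ 2 + s ^+ 2))^-1 else 0.

(* Main.v *)
(** Each iterate z_{k+1} of rPPA, together with the residual
    D = ((Theta_k - Theta_{k+1}) / sigma_k, (Omega_k - Omega_{k+1}) / sigma_k,
         Theta_{k+1} - Omega_{k+1}),
    lies in the graph of T_L, and z_{k+1} + sigma_k D differs from z_k by
    sigma_k times the gradient controlled by the stopping criterion. So
    monotonicity of T_L gives an approximate Fejer inequality, whence D -> 0,
    and an error bound turns D -> 0 into convergence.
    The error bound needs no polyhedrality of the regularizer: with A = C C^T and
    B = D D^T (Cholesky),
      |B - A|^2 <= tr A tr B <A^-1 - B^-1, B - A>,
    which also applies to A^-1 and B^-1; together with the monotonicity of the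
    subdifferential of P, it bounds the errors in Omega and in its inverse by a
    multiple of the residual.
    For the rate, z_{k+1} is the exact resolvent of z_{k+1} + sigma_k D, to which
    the exact contraction estimate applies. *)
From HB Require Import structures.
Require Import Defs.
From mathcomp Require Import all_boot all_order all_algebra.
From mathcomp Require Import all_classical all_reals all_analysis.
From mathcomp Require Import ring lra.
Import Order.TTheory GRing.Theory Num.Theory.
Import numFieldNormedType.Exports.
Local Open Scope classical_set_scope.
Local Open Scope ring_scope.

Set Implicit Arguments.
Unset Strict Implicit.
Unset Printing Implicit Defensive.

(** * Inner products and the Frobenius norm *)

Section InnerProduct.
Context (R : realType) (V : innerType R).
Implicit Types u v w : V.

Lemma dotZr a u v : dot u (a *: v) = a * dot u v.
Proof. by rewrite dotC dotZl dotC. Qed.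

Lemma dot0l u : dot 0 u = 0.
Proof. by rewrite dotC dot0r. Qed.

Lemma dotBl u v w : dot (u - v) w = dot u w - dot v w.
Proof. by rewrite dotDl dotNl. Qed.

Lemma dotBr u v w : dot u (v - w) = dot u v - dot u w.
Proof. by rewrite dotDr dotNr. Qed.

Lemma enorm_ge0 u : 0 <= enorm u. Proof. exact: sqrtr_ge0. Qed.

Lemma sqr_enorm u : enorm u ^+ 2 = dot u u.
Proof. exact: sqr_sqrtr (dot_ge0 u). Qed.

Lemma enorm0 : enorm (0 : V) = 0.
Proof. by rewrite /enorm dot0r sqrtr0. Qed.

Lemma enorm_le u c : 0 <= c -> dot u u <= c ^+ 2 -> enorm u <= c.
Proof. by move=> c0 uc; rewrite -(@ler_pXn2r _ 2) ?nnegrE ?enorm_ge0 // sqr_enorm. Qed.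

Lemma enorm_sqr_le0 u : enorm u ^+ 2 <= 0 -> u = 0.
Proof.
by rewrite sqr_enorm => u0; apply/dot_eq0/eqP; rewrite eq_le u0 dot_ge0.
Qed.

Lemma enorm_eq0 u : enorm u = 0 -> u = 0.
Proof. by move=> u0; apply: enorm_sqr_le0; rewrite u0 expr0n. Qed.

Lemma enormZ a u : enorm (a *: u) = `|a| * enorm u.
Proof.
by rewrite /enorm dotZl dotZr mulrA -expr2 sqrtrM ?sqr_ge0// sqrtr_sqr.
Qed.

Lemma enormN u : enorm (- u) = enorm u.
Proof. by rewrite /enorm dotNl dotNr opprK. Qed.

Lemma enormBC u v : enorm (u - v) = enorm (v - u).
Proof. by rewrite -enormN opprB. Qed.

(** Cauchy-Schwarz, from nonnegativity of the squared norm of [dot v v *: u - dot u v *: v]. *)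
Lemma dot_le_enorm u v : dot u v <= enorm u * enorm v.
Proof.
have [v0|v0] := eqVneq v 0.
  by rewrite v0 dot0r enorm0 mulr0.
have vv : 0 < dot v v.
  by rewrite lt_neqAle dot_ge0 andbT eq_sym; apply: contra v0 => /eqP/dot_eq0 ->.
have : dot u v ^+ 2 <= dot u u * dot v v.
  have := dot_ge0 (dot v v *: u - dot u v *: v).
  rewrite dotBl !dotBr !dotZl !dotZr (dotC v u).
  set a := dot v v; set b := dot u v; set c := dot u u => H.
  have {}H : 0 <= a * (c * a - b ^+ 2) by move: H; congr (0 <= _); ring.
  by move: H; rewrite pmulr_rge0 // subr_ge0.
rewrite -!sqr_enorm -exprMn => H.
apply: (le_trans (ler_norm _)).
by rewrite -(@ler_pXn2r _ 2) ?nnegrE ?mulr_ge0 ?enorm_ge0 // real_normK ?num_real.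
Qed.

Lemma norm_dot_le u v : `|dot u v| <= enorm u * enorm v.
Proof.
rewrite ler_norml dot_le_enorm andbT lerNl -dotNl -(enormN u).
exact: dot_le_enorm.
Qed.

Lemma enormD u v : enorm (u + v) <= enorm u + enorm v.
Proof.
apply: enorm_le; first by rewrite addr_ge0 ?enorm_ge0.
rewrite dotDl !dotDr (dotC v u) -!sqr_enorm sqrrD mulr2n.
have := dot_le_enorm u v; lra.
Qed.

Lemma enormB u v : enorm (u - v) <= enorm u + enorm v.
Proof. by rewrite -(enormN v) enormD. Qed.

Lemma enormDB u v w : enorm (u - w) <= enorm (u - v) + enorm (v - w).
Proof. by apply: le_trans (enormD _ _); rewrite addrA subrK. Qed.

End InnerProduct.

Section Components.
Context (R : realType).

Lemma dot_pair (V W : innerType R) (u v : V * W) :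
  dot u v = dot u.1 v.1 + dot u.2 v.2.
Proof. by []. Qed.

Lemma enorm_fst (V W : innerType R) (u : V * W) : enorm u.1 <= enorm u.
Proof.
by apply: enorm_le; rewrite ?enorm_ge0// sqr_enorm dot_pair lerDl dot_ge0.
Qed.

Lemma enorm_snd (V W : innerType R) (u : V * W) : enorm u.2 <= enorm u.
Proof.
by apply: enorm_le; rewrite ?enorm_ge0// sqr_enorm dot_pair lerDr dot_ge0.
Qed.

Lemma enorm_pair_le (V W : innerType R) (u : V * W) :
  enorm u <= enorm u.1 + enorm u.2.
Proof.
apply: enorm_le; first by rewrite addr_ge0 ?enorm_ge0.
rewrite dot_pair -!sqr_enorm.
have := enorm_ge0 u.1; have := enorm_ge0 u.2; nra.
Qed.

Lemma dot_ffun (I : finType) (V : innerType R) (u v : {ffun I -> V}) :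
  dot u v = \sum_i dot (u i) (v i).
Proof. by []. Qed.

Lemma enorm_ffun (I : finType) (V : innerType R) (u : {ffun I -> V}) i :
  enorm (u i) <= enorm u.
Proof.
apply: enorm_le; rewrite ?enorm_ge0// sqr_enorm dot_ffun (bigD1 i) //= lerDl.
by apply: sumr_ge0 => j _; exact: dot_ge0.
Qed.

End Components.

Section Frobenius.
Context (R : realType) (m n : nat).
Implicit Types A B C : matrix R m n.

(** Defined on all rectangular matrices, because row vectors and Cholesky factors are not symmetric;
    [enorm_symmx] links the norm to that of ['S[R]_p]. *)
Definition frob_dot A B : R := \sum_i \sum_j A i j * B i j.
Fact frob_dotC A B : frob_dot A B = frob_dot B A.
Proof. by apply: eq_bigr => i _; apply: eq_bigr => j _; rewrite mulrC. Qed.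
Fact frob_dotDl A B C : frob_dot (A + B) C = frob_dot A C + frob_dot B C.
Proof.
rewrite -big_split; apply: eq_bigr => i _; rewrite -big_split.
by apply: eq_bigr => j _; rewrite mxE mulrDl.
Qed.
Fact frob_dotZl a A B : frob_dot (a *: A) B = a * frob_dot A B.
Proof.
rewrite mulr_sumr; apply: eq_bigr => i _; rewrite mulr_sumr.
by apply: eq_bigr => j _; rewrite mxE mulrA.
Qed.
Fact frob_dot_ge0 A : 0 <= frob_dot A A.
Proof. by do 2!apply: sumr_ge0 => ? _; rewrite -expr2 sqr_ge0. Qed.
Fact frob_dot_eq0 A : frob_dot A A = 0 -> A = 0.
Proof.
move=> /eqP; rewrite psumr_eq0 => [/allP A0|i _]; last first.
  by apply: sumr_ge0 => ? _; rewrite -expr2 sqr_ge0.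
apply/matrixP => i j /=; rewrite mxE.
have := A0 i (mem_index_enum i); rewrite /= psumr_eq0 => [/allP Ai0|? _]; last first.
  by rewrite -expr2 sqr_ge0.
by have := Ai0 j (mem_index_enum j); rewrite /= mulf_eq0 orbb => /eqP.
Qed.
HB.instance Definition _ := Lmodule_isInner.Build R (matrix R m n)
  frob_dotC frob_dotDl frob_dotZl frob_dot_ge0 frob_dot_eq0.

Lemma frob_dotE A B : dot A B = \tr (A *m B^T).
Proof. by apply: eq_bigr => i _; rewrite mxE; apply: eq_bigr => j _; rewrite mxE. Qed.

End Frobenius.

Section FrobeniusNorm.
Context (R : realType).

Lemma dot_symmx p (A B : 'S[R]_p) : dot A B = \tr (A *m B :> 'M[R]_p).
Proof. by []. Qed.

Lemma symmx_tr p (A : 'S[R]_p) : (A : 'M[R]_p)^T = A.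
Proof. by case: A => A /= /eqP. Qed.

Lemma enorm_symmx p (A : 'S[R]_p) : enorm (A : 'M[R]_p) = enorm A.
Proof. by rewrite /enorm frob_dotE symmx_tr. Qed.

Lemma enorm_trmx m n (A : matrix R m n) : enorm A^T = enorm A.
Proof. by rewrite /enorm !frob_dotE trmxK mxtrace_mulC. Qed.

(** Each entry of the product pairs a row of [A] with a row of [B^T], so Cauchy-Schwarz applies
    entrywise. *)
Lemma enormM m n q (A : matrix R m n) (B : matrix R n q) :
  enorm (A *m B) <= enorm A * enorm B.
Proof.
apply: enorm_le; first by rewrite mulr_ge0 ?enorm_ge0.
rewrite exprMn -[enorm B]enorm_trmx !sqr_enorm.
have rows k l (C : matrix R k l) : dot C C = \sum_i dot (row i C) (row i C).
  apply: eq_bigr => i _; rewrite [RHS]big_ord1.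
  by apply: eq_bigr => j _; rewrite !mxE.
rewrite (rows _ _ A) (rows _ _ B^T) mulr_suml; apply: ler_sum => i _.
rewrite mulr_sumr; apply: ler_sum => j _.
have -> : (A *m B) i j = dot (row i A) (row j B^T).
  by rewrite mxE [RHS]big_ord1; apply: eq_bigr => k _; rewrite !mxE.
rewrite -expr2 -!sqr_enorm -exprMn -[leLHS]real_normK ?num_real//.
by rewrite ler_pXn2r ?nnegrE ?mulr_ge0 ?enorm_ge0// norm_dot_le.
Qed.

Lemma norm_trM m n (A : matrix R m n) (B : matrix R n m) :
  `|\tr (A *m B)| <= enorm A * enorm B.
Proof. by rewrite -(trmxK B) -frob_dotE enorm_trmx norm_dot_le. Qed.

End FrobeniusNorm.

(** * Positive definite matrices *)

Section PositiveDefinite.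
Context (R : realType).

Definition posdef n (A : 'M[R]_n) : Prop :=
  A^T = A /\ forall x : 'rV[R]_n, x != 0 -> 0 < (x *m A *m x^T) 0 0.

Lemma quad_gram m n (x : 'rV[R]_m) (C : matrix R m n) :
  (x *m (C *m C^T) *m x^T) 0 0 = enorm (x *m C) ^+ 2.
Proof.
by rewrite sqr_enorm frob_dotE [\tr _]big_ord1 trmx_mul !mulmxA.
Qed.

(** Induction on the size: split off the first row and column, then factor the Schur complement [D]
    of the corner entry. *)
Lemma cholesky n (A : 'M[R]_n) : posdef A ->
  exists C : 'M[R]_n, [/\ is_trig_mx C, forall i, 0 < C i i & A = C *m C^T].
Proof.
elim: n A => [|n IHn] A [AT Apos].
  by exists 0; split => [|[]//|]; rewrite ?mx0_is_trig// [A]flatmx0 mul0mx.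
set a := A 0 0; change (matrix R (1 + n) (1 + n)) in (type of A).
have {}Apos (x : matrix R 1 (1 + n)) : x != 0 -> 0 < (x *m A *m x^T) 0 0 by exact: Apos.
set v := ursubmx A; set B := drsubmx A.
have ulA : ulsubmx A = a%:M.
  by rewrite [LHS]mx11_scalar mxE mxE; congr (A _ _)%:M; apply/val_inj.
have dlA : dlsubmx A = v^T by rewrite /v trmx_ursub AT.
have BT : B^T = B by rewrite /B trmx_drsub AT.
have defA : A = block_mx a%:M v v^T B by rewrite -ulA -dlA submxK.
have a0 : 0 < a.
  have /Apos : row_mx 1%:M 0 != 0 :> matrix R 1 (1 + n).
    apply/eqP => /matrixP/(_ 0 (lshift n 0)); rewrite row_mxEl !mxE /=.
    by move/eqP; rewrite oner_eq0.
  rewrite defA tr_row_mx mul_row_block mul_row_col !mul1mx !mul0mx !addr0 trmx1.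
  by rewrite mulmx1 trmx0 mulmx0 addr0 mxE eqxx.
pose D := B - a^-1 *: (v^T *m v).
have [C [Ctrig Cpos defC]] : exists C : 'M[R]_n,
    [/\ is_trig_mx C, forall i, 0 < C i i & D = C *m C^T].
  apply: IHn; split.
    by rewrite /D linearB /= linearZ /= trmx_mul trmxK BT.
  move=> y y0.
  (* At this vector the quadratic form of [A] equals that of the Schur complement at [y]. *)
  pose x : matrix R 1 (1 + n) := row_mx (- a^-1 *: (y *m v^T)) y.
  have /Apos : x != 0.
    apply: contra y0 => /eqP x0; apply/eqP.
    by rewrite -(row_mxKr (- a^-1 *: (y *m v^T)) y) -/x x0 linear0.
  rewrite defA /x mul_row_block tr_row_mx mul_row_col.
  rewrite mul_mx_scalar scalerA mulrN divff ?gt_eqF// scaleN1r addNr mul0mx add0r.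
  suff -> : - a^-1 *: (y *m v^T) *m v + y *m B = y *m D by [].
  by rewrite /D mulmxBr -scalemxAl -scalemxAr scaleNr addrC mulmxA.
pose s := Num.sqrt a.
have s0 : 0 < s by rewrite sqrtr_gt0.
have ss : s * s = a by rewrite -expr2 sqr_sqrtr// ltW.
pose G : matrix R (1 + n) (1 + n) := block_mx s%:M 0 (s^-1 *: v^T) C.
have defG : A = G *m G^T.
  rewrite /G tr_block_mx trmx0 tr_scalar_mx linearZ /= trmxK mulmx_block.
  rewrite !mul0mx !mulmx0 !addr0 -scalar_mxM ss -defC.
  rewrite mul_scalar_mx mul_mx_scalar !scalerA divff ?gt_eqF// !scale1r.
  rewrite -scalemxAl -scalemxAr scalerA -invfM ss /D addrC subrK.
  exact: defA.
exists G; split=> //.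
- rewrite /G (is_trig_block_mx _ _ _ _ (erefl 1%N)) eqxx Ctrig andbT /=.
  exact: mx11_is_trig.
- move=> i; rewrite -[i](@splitK 1 n) /G; case: (fintype.split _) => j /=.
    by rewrite (block_mxEul s%:M 0 (s^-1 *: v^T) C) ord1 mxE eqxx.
  by rewrite (block_mxEdr s%:M 0 (s^-1 *: v^T) C).
Qed.

Section Factorization.
Context (n : nat) (A : 'M[R]_n).
Hypothesis Apd : posdef A.

Lemma posdef_det_gt0 : 0 < \det A.
Proof.
have [C [Ctrig Cpos ->]] := cholesky Apd.
rewrite det_mulmx det_tr det_trig// -expr2 exprn_gt0// prodr_gt0//.
Qed.

Lemma posdef_unit : A \in unitmx.
Proof. by rewrite unitmxE unitfE gt_eqF// posdef_det_gt0. Qed.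

Lemma posdef_inv : posdef (invmx A).
Proof.
split=> [|x x0]; first by rewrite trmx_inv (proj1 Apd).
have -> : x *m invmx A *m x^T = (x *m invmx A) *m A *m (x *m invmx A)^T.
  by rewrite trmx_mul trmx_inv (proj1 Apd) mulmxKV ?posdef_unit// mulmxA.
apply: (proj2 Apd); apply: contra x0 => /eqP x0.
by rewrite -[x](mulmxKV posdef_unit) x0 mul0mx.
Qed.

Lemma posdef_factor : exists C : 'M[R]_n,
  [/\ C \in unitmx, A = C *m C^T, invmx A = (invmx C)^T *m invmx C,
      enorm C ^+ 2 = \tr A & enorm (invmx C) ^+ 2 = \tr (invmx A)].
Proof.
have [C [Ctrig Cpos defA]] := cholesky Apd.
have uC : C \in unitmx.
  by have := posdef_unit; rewrite defA unitmx_mul => /andP[].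
have invA : invmx A = (invmx C)^T *m invmx C.
  apply: (can_inj (mulmxK posdef_unit)); rewrite mulVmx ?posdef_unit// defA.
  by rewrite !mulmxA mulmxKV// -trmx_mul mulmxV// trmx1.
exists C; split=> //; first by rewrite sqr_enorm frob_dotE defA.
by rewrite sqr_enorm frob_dotE invA mxtrace_mulC.
Qed.

Lemma posdef_tr_ge0 : 0 <= \tr A.
Proof. by have [C [_ _ _ <- _]] := posdef_factor; rewrite exprn_ge0 ?enorm_ge0. Qed.

(** The trace of the inverse stands in for the reciprocal of the smallest eigenvalue: write [x] as
    [x *m C *m invmx C] with [A = C C^T]. *)
Lemma posdef_lower_bound (x : 'rV[R]_n) :
  enorm x ^+ 2 <= \tr (invmx A) * (x *m A *m x^T) 0 0.
Proof.
have [C [uC defA _ _ <-]] := posdef_factor.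
rewrite defA quad_gram mulrC -exprMn ler_pXn2r ?nnegrE ?mulr_ge0 ?enorm_ge0//.
by rewrite -{1}[x](mulmxK uC) enormM.
Qed.

End Factorization.

(* With A = C C^T and B = D D^T, the trace on the right is the squared norm of
   N = C^-1 E D^-T, and E = C N D^T. *)
Lemma posdef_sandwich n (A B E : 'M[R]_n) : posdef A -> posdef B ->
  enorm E ^+ 2 <= \tr A * \tr B * \tr (invmx A *m E *m invmx B *m E^T).
Proof.
move=> /posdef_factor[C [uC _ -> <- _]] /posdef_factor[D [uD _ -> <- _]].
set N := invmx C *m E *m (invmx D)^T.
have -> : \tr ((invmx C)^T *m invmx C *m E *m ((invmx D)^T *m invmx D) *m E^T) =
    enorm N ^+ 2.
  rewrite sqr_enorm frob_dotE /N !trmx_mul trmxK -!mulmxA mxtrace_mulC.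
  by rewrite !mulmxA.
have -> : E = C *m N *m D^T.
  rewrite /N !mulmxA mulmxV// mul1mx -mulmxA -trmx_mul mulmxV// trmx1 mulmx1//.
rewrite -!exprMn ler_pXn2r ?nnegrE ?mulr_ge0 ?enorm_ge0//.
apply: le_trans (enormM _ _) _; rewrite enorm_trmx mulrAC.
by rewrite ler_wpM2r ?enorm_ge0// enormM.
Qed.

(** For a Cholesky factor [C], the determinant is the product of the [C i i ^+ 2], each at most
    [expR (C i i ^+ 2 - 1)], while the trace sums the squares of all entries of [C]. *)
Lemma posdef_det_le n (A : 'M[R]_n) : posdef A ->
  \det A <= expR (\tr A - n%:R).
Proof.
move=> /cholesky[C [Ctrig Cpos ->]].
rewrite det_mulmx det_tr det_trig// -big_split /=.
apply: (@le_trans _ _ (\prod_(i < n) expR (C i i ^+ 2 - 1))).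
  apply: ler_prod => i _; rewrite -expr2 sqr_ge0/=.
  by have := expR_ge1Dx (C i i ^+ 2 - 1); rewrite addrC subrK.
rewrite -expR_sum ler_expR sumrB sumr_const card_ord lerD2r.
apply: ler_sum => i _; rewrite mxE (bigD1 i)//= mxE -expr2 lerDl.
by apply: sumr_ge0 => j _; rewrite mxE -expr2 sqr_ge0.
Qed.

(** Concavity of the log-determinant: apply [posdef_det_le] to [C^-1 B C^-T] with [A = C C^T], whose
    determinant is [\det B / \det A] and whose trace is that of [A^-1 B]. *)
Lemma posdef_lndet_le n (A B : 'M[R]_n) : posdef A -> posdef B ->
  ln (\det B) <= ln (\det A) + \tr (invmx A *m (B - A)).
Proof.
move=> Apd Bpd; have [C [uC defA invA _ _]] := posdef_factor Apd.
have Mpd : posdef (invmx C *m B *m (invmx C)^T).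
  split; first by rewrite !trmx_mul trmxK (proj1 Bpd) mulmxA.
  move=> x x0.
  have -> : x *m (invmx C *m B *m (invmx C)^T) *m x^T =
            (x *m invmx C) *m B *m (x *m invmx C)^T.
    by rewrite trmx_mul !mulmxA.
  apply: (proj2 Bpd); apply: contra x0 => /eqP x0.
  by rewrite -[x](mulmxKV uC) x0 mul0mx.
have := posdef_det_le Mpd.
have -> : \det (invmx C *m B *m (invmx C)^T) = \det B / \det A.
  rewrite !det_mulmx det_tr det_inv defA det_mulmx det_tr invfM.
  by rewrite mulrAC [RHS]mulrC.
rewrite mxtrace_mulC mulmxA -invA => H.
have dA := posdef_det_gt0 Apd; have dB := posdef_det_gt0 Bpd.
rewrite mulmxBr mulVmx ?posdef_unit// linearB /= mxtrace1 addrC -lerBlDr.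
rewrite -ln_div ?posrE// -ler_expR lnK ?posrE ?divr_gt0//.
Qed.

End PositiveDefinite.

(** Replaces the passage to the limit [t -> 0] in the first-order arguments below. *)
Lemma le0_of_le_small (R : realType) (x t0 K : R) : 0 < t0 -> 0 <= K ->
  (forall t, 0 < t -> t <= t0 -> x <= t * K) -> x <= 0.
Proof.
move=> t00 K0 xK; rewrite leNgt; apply/negP => x0.
pose t := Num.min t0 (x / (2 * (K + 1))).
have s0 : 0 < x / (2 * (K + 1)) by rewrite divr_gt0//; lra.
have := xK t; rewrite lt_min t00 s0 ge_min lexx => /(_ isT isT).
apply/negP; rewrite -ltNge; apply: (@le_lt_trans _ _ (x / (2 * (K + 1)) * K)).
  by rewrite ler_wpM2r// ge_min lexx orbT.
rewrite mulrAC ltr_pdivrMr; nra.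
Qed.

(** * The log-determinant on symmetric matrices *)

Section LogDet.
Context (R : realType) (p : nat).
Implicit Types A B E F : 'S[R]_p.

Lemma symmx_addE A B : (A + B : 'S[R]_p) = (A : 'M[R]_p) + B :> 'M[R]_p.
Proof. exact: (raddfD (val : 'S[R]_p -> 'M[R]_p)). Qed.

Lemma symmx_subE A B : (A - B : 'S[R]_p) = (A : 'M[R]_p) - B :> 'M[R]_p.
Proof. exact: (raddfB (val : 'S[R]_p -> 'M[R]_p)). Qed.

Lemma symmx_scaleE a A : (a *: A : 'S[R]_p) = a *: (A : 'M[R]_p) :> 'M[R]_p.
Proof. by rewrite -[@symmx_val R p]/val linearZ. Qed.

Lemma pdmx_posdef A : pdmx A -> posdef A.
Proof. by split; first exact: symmx_tr. Qed.

Fact symm_inv_subproof A : invmx A \in @symmx_pred R p.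
Proof. by rewrite inE trmx_inv symmx_tr. Qed.
Definition symm_inv A : 'S[R]_p := SymMx (symm_inv_subproof A).

Lemma symm_inv_pd A : pdmx A -> pdmx (symm_inv A).
Proof. by move=> /pdmx_posdef/posdef_inv[]. Qed.

Lemma symm_invK : involutive symm_inv.
Proof. by move=> A; apply: val_inj; rewrite /= invmxK. Qed.

Lemma symmx_tr_le A : \tr A <= Num.sqrt p%:R * enorm A.
Proof.
rewrite -[X in \tr X]mul1mx; apply: (le_trans (ler_norm _)).
apply: le_trans (norm_trM _ _) _; rewrite enorm_symmx.
by rewrite /enorm frob_dotE trmx1 mulmx1 mxtrace1.
Qed.

(** The identity [A^-1 (B - A) B^-1 = A^-1 - B^-1] turns [posdef_sandwich] into strong monotonicity
    of minus the inverse, with a modulus given by traces. *)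
Lemma symm_inv_monotone A B : pdmx A -> pdmx B ->
  enorm (B - A) ^+ 2 <=
  \tr A * \tr B * dot (symm_inv A - symm_inv B) (B - A).
Proof.
move=> /pdmx_posdef Apd /pdmx_posdef Bpd.
rewrite -enorm_symmx; apply: le_trans (posdef_sandwich _ Apd Bpd) _.
suff -> : invmx A *m (B - A : 'S[R]_p) *m invmx B = (symm_inv A - symm_inv B : 'S[R]_p).
  by rewrite symmx_tr dot_symmx.
rewrite !symmx_subE mulmxBr mulmxBl mulVmx ?posdef_unit// mul1mx.
by rewrite mulmxK ?posdef_unit.
Qed.

(** Openness of the cone with an explicit radius: [posdef_lower_bound] bounds the form of [A] from
    below, and the form of [E] is at most [enorm x ^+ 2 * enorm E] in absolute value. *)
Lemma pdmx_near A E : pdmx A -> \tr (symm_inv A) * enorm E < 1 -> pdmx (A + E).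
Proof.
move=> Apd AE x x0; have Ap := pdmx_posdef Apd.
have t0 := posdef_tr_ge0 (posdef_inv Ap).
rewrite symmx_addE mulmxDr mulmxDl mxE.
have := posdef_lower_bound Ap x.
set q := (x *m A *m x^T) 0 0; set r := (x *m E *m x^T) 0 0.
have rE : `|r| <= enorm x ^+ 2 * enorm E.
  have -> : r = \tr (x *m E *m x^T) by rewrite [RHS]big_ord1.
  apply: le_trans (norm_trM _ _) _; rewrite enorm_trmx expr2 mulrAC.
  by rewrite ler_wpM2r ?enorm_ge0// -(enorm_symmx E) enormM.
have x1 : 0 < enorm x ^+ 2.
  rewrite exprn_gt0// lt_neqAle enorm_ge0 andbT eq_sym.
  by apply: contra x0 => /eqP x0; apply/eqP/enorm_eq0.
move: AE t0 => /=; set t := \tr _ => AE t0 qx.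
have /ler_normlP[rE1 rE2] := rE.
have : 0 < t * (q + r).
  have : enorm x ^+ 2 * (t * enorm E) < enorm x ^+ 2 by rewrite gtr_pMr.
  have : t * - r <= t * (enorm x ^+ 2 * enorm E) by rewrite ler_wpM2l.
  lra.
by rewrite mulrDr; nra.
Qed.

Lemma lndet_le A B : pdmx A -> pdmx B ->
  ln (\det B) <= ln (\det A) + dot (symm_inv A) (B - A).
Proof.
move=> /pdmx_posdef Apd /pdmx_posdef Bpd; rewrite dot_symmx symmx_subE.
exact: posdef_lndet_le.
Qed.

Lemma pdmx_mid A B : pdmx A -> pdmx B -> pdmx (2^-1 *: (A + B)).
Proof.
move=> Apd Bpd x x0; rewrite symmx_scaleE symmx_addE -scalemxAr -scalemxAl mxE.
by rewrite mulmxDr mulmxDl mxE mulr_gt0 ?invr_gt0// addr_gt0 ?Apd ?Bpd.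
Qed.

(* Equality at B forces the inequality to be tight up to the midpoint of A and
   B, against strict monotonicity of the inverse. *)
Lemma lndet_eq A B : pdmx A -> pdmx B ->
  ln (\det A) + dot (symm_inv A) (B - A) <= ln (\det B) -> B = A.
Proof.
move=> Apd Bpd AB; pose C := 2^-1 *: (A + B).
have Cpd : pdmx C by exact: pdmx_mid.
have BA : B - A = (C - A) + (C - A).
  have CC : C + C = A + B.
    by rewrite -scalerDl (_ : 2^-1 + 2^-1 = 1) ?scale1r//; lra.
  by rewrite [RHS]addrACA CC addrACA subrr add0r.
have BC : B - C = C - A.
  by apply: (addIr (C - A)); rewrite addrA subrK -BA.
have := lndet_le Apd Cpd; have := lndet_le Cpd Bpd; rewrite BC => H1 H2.
move: AB; rewrite BA dotDr => AB.
have : enorm (C - A) ^+ 2 <= 0.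
  apply: le_trans (symm_inv_monotone Apd Cpd) _.
  rewrite mulr_ge0_le0//; first by rewrite mulr_ge0// posdef_tr_ge0//; exact: pdmx_posdef.
  by rewrite dotBl; lra.
move=> /enorm_sqr_le0 CA.
by apply/eqP; rewrite -subr_eq0 BA CA addr0.
Qed.

(** First-order optimality without differentiating: test at [B = A + t F] with [F = s A^-1 - W].
    Since [B^-1] is within [O(t)] of [A^-1], dividing by [t] bounds [|F|^2] by a multiple of [t].
    Subgradients use [c = 0], proximal points [c = 1/2]. *)
Lemma lndet_first_order (s c : R) A W : pdmx A -> 0 <= s -> 0 <= c ->
  (forall B, pdmx B ->
    s * dot (symm_inv B) (B - A) <= dot W (B - A) + c * enorm (B - A) ^+ 2) ->
  W = s *: symm_inv A.
Proof.
move=> Apd s0 c0 H.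
pose F := s *: symm_inv A - W; pose i := enorm (symm_inv A).
pose tau := \tr (symm_inv A).
have tau0 : 0 <= tau := posdef_tr_ge0 (posdef_inv (pdmx_posdef Apd)).
have i0 : 0 <= i := enorm_ge0 _.
have F0 : 0 <= enorm F := enorm_ge0 _.
suff : enorm F ^+ 2 <= 0.
  by move=> /enorm_sqr_le0/eqP; rewrite subr_eq0 => /eqP.
have K0 : 0 < 1 + enorm F * (tau + 2 * i).
  by rewrite ltr_pwDl// mulr_ge0// addr_ge0// mulr_ge0.
(* This threshold makes [t * enorm F * tau < 1], so that [A + t F] is positive definite, and
   [t * enorm F * i <= 1/2], so that its inverse has norm at most [2 * i]. *)
apply: (@le0_of_le_small _ _ (1 + enorm F * (tau + 2 * i))^-1
    ((c + s * (i * (2 * i))) * enorm F ^+ 2)).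
- by rewrite invr_gt0.
- by rewrite mulr_ge0 ?sqr_ge0// addr_ge0// !mulr_ge0.
move=> t t0; rewrite -[_^-1]div1r ler_pdivlMr// => tK.
have tF : t * enorm F * tau < 1.
  have : 0 <= t * (enorm F * i) by rewrite !mulr_ge0// ltW.
  by move: tK; rewrite !mulrDr; lra.
have tFi : t * enorm F * i <= 2^-1.
  have : 0 <= t * (enorm F * tau) by rewrite !mulr_ge0// ltW.
  by move: tK; rewrite !mulrDr; lra.
pose B := A + t *: F.
have Bpd : pdmx B by apply: pdmx_near; rewrite // enormZ gtr0_norm// mulrC.
have BA : B - A = t *: F by rewrite /B addrC addKr.
have uA := posdef_unit (pdmx_posdef Apd).
have uB := posdef_unit (pdmx_posdef Bpd).
have eqD : invmx A = invmx B + t *: (invmx A *m F *m invmx B).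
  apply: (can_inj (mulmxK uB)); rewrite mulmxDl mulVmx// -scalemxAl.
  rewrite mulmxKV// {1}/B symmx_addE symmx_scaleE mulmxDr mulVmx//.
  by rewrite -scalemxAr.
have FD : enorm (invmx A *m F *m invmx B) <= i * enorm F * enorm (symm_inv B).
  apply: le_trans (enormM _ _) _; rewrite -(enorm_symmx (symm_inv B)).
  rewrite ler_wpM2r ?enorm_ge0//; apply: le_trans (enormM _ _) _.
  by rewrite /i -(enorm_symmx (symm_inv A)) -(enorm_symmx F).
(* By [eqD], this norm is at most [i] plus half of itself. *)
have D2 : enorm (symm_inv B) <= 2 * i.
  have : enorm (symm_inv B) <= i + t * enorm (invmx A *m F *m invmx B).
    have -> : t * enorm (invmx A *m F *m invmx B) =
              enorm (t *: (invmx A *m F *m invmx B)) by rewrite enormZ gtr0_norm.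
    have -> : i = enorm (invmx A) by rewrite /i -(enorm_symmx (symm_inv A)).
    rewrite -(enorm_symmx (symm_inv B)) /=.
    by rewrite -{1}[invmx B](addrK (t *: (invmx A *m F *m invmx B))) -eqD enormB.
  have : t * enorm (invmx A *m F *m invmx B) <= 2^-1 * enorm (symm_inv B).
    apply: (@le_trans _ _ (t * (i * enorm F * enorm (symm_inv B)))).
      by rewrite ler_wpM2l// ltW.
    by rewrite !mulrA ler_wpM2r ?enorm_ge0// mulrAC.
  by lra.
have := H B Bpd; rewrite BA !dotZr enormZ gtr0_norm//.
have -> : dot (symm_inv B) F =
    dot (symm_inv A) F - t * \tr (invmx A *m F *m invmx B *m F).
  rewrite !dot_symmx /=.
  rewrite -[X in \tr (X *m F) = _](addrK (t *: (invmx A *m F *m invmx B))) -eqD.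
  by rewrite mulmxBl linearB /= -scalemxAl mxtraceZ.
have : \tr (invmx A *m F *m invmx B *m F) <= i * (2 * i) * enorm F ^+ 2.
  apply: (le_trans (ler_norm _)); apply: (le_trans (norm_trM _ _)).
  rewrite enorm_symmx expr2 mulrA ler_wpM2r//.
  apply: (le_trans FD); rewrite mulrAC ler_wpM2r// ler_wpM2l//.
set T := \tr _ => TF HB.
have {}HB : t * (s * (dot (symm_inv A) F - t * T)) <=
    t * (dot W F + t * c * enorm F ^+ 2).
  rewrite mulrCA; apply: (le_trans HB).
  have -> : t * dot W F + c * (t * enorm F) ^+ 2 =
    t * (dot W F + t * c * enorm F ^+ 2) by ring.
  exact: lexx.
rewrite ler_pM2l// in HB.
have sT : t * (s * T) <= t * (s * (i * (2 * i) * enorm F ^+ 2)).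
  by rewrite ler_wpM2l ?(ltW t0)// ler_wpM2l.
have FE : enorm F ^+ 2 = s * dot (symm_inv A) F - dot W F.
  by rewrite sqr_enorm {1}/F dotBl dotZl.
set f := enorm F ^+ 2 in FE HB sT *.
by move: HB sT; rewrite !(mulrBr, mulrDl, mulrDr, mulrA); lra.
Qed.

End LogDet.

(** * Convexity and proximal points *)

Section Convexity.
Context (R : realType) (V : innerType R).

Definition convex_real (f : V -> R) : Prop :=
  forall x y t, 0 <= t -> t <= 1 -> f (x + t *: (y - x)) <= f x + t * (f y - f x).

Lemma convex_real_sum (I : finType) (P : pred I) (f : I -> V -> R) :
  (forall i, P i -> convex_real (f i)) ->
  convex_real (fun x => \sum_(i | P i) f i x).
Proof.
move=> fc x y t t0 t1; rewrite -sumrB mulr_sumr -big_split /=.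
by apply: ler_sum => i Pi; exact: fc.
Qed.

Lemma convex_realD (f g : V -> R) :
  convex_real f -> convex_real g -> convex_real (fun x => f x + g x).
Proof.
move=> fc gc x y t t0 t1; have := fc x y t t0 t1; have := gc x y t t0 t1.
rewrite !mulrBr !mulrDr; lra.
Qed.

Lemma convex_realZ (c : R) (f : V -> R) :
  0 <= c -> convex_real f -> convex_real (fun x => c * f x).
Proof.
move=> c0 fc x y t t0 t1; rewrite -mulrBr mulrCA -mulrDr ler_wpM2l//.
exact: fc.
Qed.

Lemma convex_real_norm (f : V -> R) :
  (forall x y t, f (x + t *: (y - x)) = f x + t * (f y - f x)) ->
  convex_real (fun x => `|f x|).
Proof.
move=> fl x y t t0 t1; rewrite fl.
have -> : f x + t * (f y - f x) = (1 - t) * f x + t * f y by ring.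
apply: (le_trans (ler_normD _ _)).
rewrite !normrM (ger0_norm t0) ger0_norm ?subr_ge0//; lra.
Qed.

Lemma sqr_enormD (u v : V) :
  enorm (u + v) ^+ 2 = enorm u ^+ 2 + 2 * dot u v + enorm v ^+ 2.
Proof. by rewrite !sqr_enorm dotDl !dotDr (dotC v u); lra. Qed.

Lemma sqr_enorm_shift (u v y : V) :
  enorm (y - u) ^+ 2 =
  enorm (v - u) ^+ 2 + 2 * dot (v - u) (y - v) + enorm (y - v) ^+ 2.
Proof.
have -> : y - u = (v - u) + (y - v) by rewrite [RHS]addrC; apply: esym; exact: subrKA.
exact: sqr_enormD.
Qed.

(** Lets the KKT system, stated with unscaled proximal maps, use the lemmas on scaled ones at step
    size 1. *)
Lemma is_prox1 (g : V -> \bar R) u v :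
  is_prox g u v -> is_prox (fun x => 1%:E * g x)%E u v.
Proof.
by rewrite (_ : (fun x => 1%:E * g x)%E = g)//; apply/funext => x; rewrite mul1e.
Qed.

(** Compare [v] with [v + t (y - v)], use convexity, divide by [t] and let [t] tend to zero. *)
Lemma prox_subdifferential (f : V -> R) (s : R) u v : 0 < s -> convex_real f ->
  is_prox (fun x => s%:E * (f x)%:E)%E u v ->
  subdifferential (EFin \o f) v (s^-1 *: (u - v)).
Proof.
move=> s0 fc [_ vmin] y; rewrite /= -EFinD lee_fin dotZl.
suff : s * (f v - f y) + dot (u - v) (y - v) <= 0.
  move=> H; rewrite -(ler_pM2l s0) mulrDr mulVKf ?gt_eqF//; lra.
apply: (@le0_of_le_small _ _ 1 (2^-1 * enorm (y - v) ^+ 2)) => //.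
  by rewrite mulr_ge0 ?invr_ge0 ?sqr_ge0.
move=> t t0 t1; rewrite -(ler_pM2l t0).
pose w := v + t *: (y - v).
have wv : w - v = t *: (y - v) by rewrite /w addrC addKr.
have := vmin w I; rewrite -!EFinM -!EFinD lee_fin.
rewrite (sqr_enorm_shift u v w) wv dotZr enormZ exprMn gtr0_norm//.
have : s * f w <= s * (f v + t * (f y - f v)).
  by rewrite ler_pM2l//; apply: fc => //; exact: ltW.
rewrite -(opprB v u) dotNl.
move: (f w) (dot _ _) (enorm (y - v) ^+ 2) (enorm (v - u) ^+ 2) => a d e g; nra.
Qed.

End Convexity.

Section FusedRegularizer.
Context (R : realType) (p L : nat) (lambda1 lambda2 : R).
Hypotheses (l1 : 0 <= lambda1) (l2 : 0 <= lambda2).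
Local Notation Y := 'Y[R]_(L, p).

Lemma entry_affine (x y : Y) t l i j :
  (x + t *: (y - x)) l i j = x l i j + t * (y l i j - x l i j).
Proof. by rewrite !ffunE symmx_addE symmx_scaleE symmx_subE !mxE. Qed.

Lemma fused_reg_convex : convex_real (fused_reg lambda1 lambda2 : Y -> R).
Proof.
apply: convex_realD; apply: convex_realZ => //.
  apply: convex_real_sum => l _; apply: convex_real_sum => i _.
  apply: convex_real_sum => j _; apply: convex_real_norm => x y t.
  exact: entry_affine.
apply: convex_real_sum => l _; apply: convex_real_sum => m _.
apply: convex_real_sum => i _; apply: convex_real_sum => j _.
by apply: convex_real_norm => x y t; rewrite !entry_affine; ring.
Qed.

End FusedRegularizer.

(** * Subgradients and proximal points of [vartheta] *)

Section Vartheta.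
Context (R : realType) (p : nat).
Implicit Types A B : 'S[R]_p.

Lemma varthetaE A : pdmx A -> vartheta A = (- ln (\det A))%:E.
Proof. by move=> Apd; rewrite /vartheta asboolT. Qed.

Lemma vartheta_fin A : vartheta A != +oo%E -> pdmx A.
Proof. by rewrite /vartheta; case: asboolP. Qed.

Lemma subdifferential_vartheta A :
  pdmx A -> subdifferential (@vartheta R p) A (- symm_inv A).
Proof.
move=> Apd B; rewrite varthetaE//.
have [Bpd|Bpd] := asboolP (pdmx B); last first.
  by rewrite /vartheta asboolF ?leey//.
rewrite varthetaE// -EFinD lee_fin dotNl.
have := lndet_le Apd Bpd; lra.
Qed.

(** The subgradient inequality at [B] and concavity at [B] together give the hypothesis of
    [lndet_first_order] for [W = - V]. *)
Lemma subdifferential_varthetaE A V :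
  subdifferential (@vartheta R p) A V -> pdmx A /\ V = - symm_inv A.
Proof.
move=> AV.
have Apd : pdmx A.
  apply: vartheta_fin; apply/eqP => Aoo.
  (* The value at the identity matrix is finite, which rules out [+oo] at [A]. *)
  have := AV (SymMx (symmx1_subproof R p)).
  by rewrite Aoo varthetaE; [rewrite addye// leye_eq|exact: pd1].
split=> //; rewrite -[V]opprK; congr (- _).
rewrite -[RHS]scale1r; apply: (@lndet_first_order _ _ 1 0) => // B Bpd.
have := AV B; rewrite !varthetaE// -EFinD lee_fin dotNl.
have := lndet_le Bpd Apd; rewrite -(opprB B A) dotNr; lra.
Qed.

(** [prox_subdifferential] covers real-valued functions; here optimality goes through
    [lndet_first_order] with [W = A - U], whose quadratic term absorbs that of the proximal
    objective. *)
Lemma prox_vartheta (s : R) U A : 0 < s ->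
  is_prox (fun x => s%:E * vartheta x)%E U A ->
  subdifferential (@vartheta R p) A (s^-1 *: (U - A)).
Proof.
move=> s0 [_ Amin].
have Apd : pdmx A.
  apply: vartheta_fin; apply/eqP => Aoo.
  have := Amin (SymMx (symmx1_subproof R p)) I.
  rewrite Aoo gt0_muley ?lte_fin// varthetaE; last exact: pd1.
  by rewrite -EFinM -EFinD addye// leye_eq.
suff -> : s^-1 *: (U - A) = - symm_inv A by exact: subdifferential_vartheta.
rewrite -(opprB A U) scalerN; congr (- _).
have -> : A - U = s *: symm_inv A.
  apply: (@lndet_first_order _ _ s 2^-1) => //; first exact: ltW.
  move=> B Bpd.
  have := Amin B I; rewrite !varthetaE// -!EFinM -!EFinD lee_fin.
  rewrite (sqr_enorm_shift U A B).
  have : s * ln (\det A) <= s * (ln (\det B) - dot (symm_inv B) (B - A)).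
    by rewrite ler_pM2l// -dotNr opprB lndet_le.
  by rewrite mulrBr !mulrN; lra.
by rewrite scalerA mulVf ?gt_eqF// scale1r.
Qed.

End Vartheta.

(** * Monotonicity of the Lagrangian operator *)

Lemma symm_inv_dot_ge0 (R : realType) p (A B : 'S[R]_p) : pdmx A -> pdmx B ->
  0 <= dot (symm_inv A - symm_inv B) (B - A).
Proof.
move=> Apd Bpd; have := lndet_le Apd Bpd; have := lndet_le Bpd Apd.
by rewrite -(opprB B A) dotNr dotBl; lra.
Qed.

(* The scalar inequalities behind the error bound: with e the size of a residual
   and x, y the errors in Omega and in its inverse, both x and y are O(e). *)
Lemma quadratic_growth_bound (R : realFieldType) (C e x y q : R) :
  1 <= C -> 0 <= e -> 16 * C * e <= 1 -> 0 <= x -> 0 <= y ->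
  x ^+ 2 <= C * (1 + x) * q -> y ^+ 2 <= C * (1 + y) * q ->
  q <= 2 * e ^+ 2 + 2 * e * x + e * y ->
  x <= 8 * C * e /\ y <= 8 * C * e.
Proof.
move=> C1 e0 Ce x0 y0 Hx Hy Hq.
(* Reduction to one variable, used below for the maximum of [x] and [y]. *)
have main m : 0 <= m -> m ^+ 2 <= C * (1 + m) * (2 * e ^+ 2 + 3 * (e * m)) ->
    m <= 8 * C * e.
  move=> m0 Hm; rewrite leNgt; apply/negP => me.
  (* If [m >= 1], then [1 + m <= 2 * m] and the smallness of [C * e] give [m <= 1/4 + 3/8 m], which
     is absurd. *)
  have m1 : m < 1.
    rewrite ltNge; apply/negP => m1.
    have em0 : 0 <= e * m by rewrite mulr_ge0.
    have h1 : C * (1 + m) * (2 * e ^+ 2 + 3 * (e * m)) <=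
              C * (2 * m) * (2 * e ^+ 2 + 3 * (e * m)).
      by rewrite ler_wpM2r ?ler_wpM2l//; nra.
    have h2 : C * (2 * m) * (2 * e ^+ 2 + 3 * (e * m)) =
              m * (4 * (C * e) * e + 6 * (C * e) * m) by ring.
    have h3 : C * e <= 16^-1 by lra.
    have Ce0 : 0 <= C * e by rewrite mulr_ge0//; lra.
    have e1 : e <= 1 by nra.
    have h4 : 4 * (C * e) * e + 6 * (C * e) * m <= 4 / 16 + 6 / 16 * m by nra.
    have h5 : m * m <= m * (4 / 16 + 6 / 16 * m).
      apply: (@le_trans _ _ (m * (4 * (C * e) * e + 6 * (C * e) * m))).
        by rewrite -expr2 -h2; apply: le_trans Hm h1.
      by rewrite ler_wpM2l.
    by nra.
  (* Now [1 + m <= 2], and [8 * C * e < m] bounds the right-hand side by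
     [(1/16 + 6/8) m^2 < m^2]. *)
  have em0 : 0 <= e * m by rewrite mulr_ge0.
  have h1 : C * (1 + m) * (2 * e ^+ 2 + 3 * (e * m)) <=
            C * 2 * (2 * e ^+ 2 + 3 * (e * m)).
    by rewrite ler_wpM2r ?ler_wpM2l//; nra.
  have h2 : C * 2 * (2 * e ^+ 2 + 3 * (e * m)) =
            4 * (C * e) * e + 6 * (C * e) * m by ring.
  have Ce0 : 0 <= C * e by rewrite mulr_ge0//; lra.
  have em : e <= m by nra.
  have h3 : 4 * (C * e) * e <= 1 / 16 * (m * m) by nra.
  have h4 : 6 * (C * e) * m <= 6 / 8 * (m * m) by nra.
  have mm : 0 < m * m by rewrite -expr2 exprn_gt0//; lra.
  by move: Hm; rewrite expr2 => Hm; lra.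
have q0 : 0 <= q.
  have : 0 <= C * (1 + x) * q by apply: le_trans Hx; rewrite sqr_ge0.
  by rewrite pmulr_rge0//; nra.
pose m := Num.max x y.
have xm : x <= m by rewrite le_max lexx.
have ym : y <= m by rewrite le_max lexx orbT.
suff : m <= 8 * C * e by split; [exact: le_trans xm _|exact: le_trans ym _].
apply: main; first exact: le_trans xm.
apply: (@le_trans _ _ (C * (1 + m) * q)); first by rewrite /m maxEle; case: ifP.
rewrite ler_wpM2l//; first by nra.
by apply: (le_trans Hq); nra.
Qed.

Section Tuples.
Context (R : realType) (p L : nat).
Local Notation Y := 'Y[R]_(L, p).
Implicit Types A B : Y.

Definition tuple_pd A : Prop := forall l, pdmx (A l).
Definition tuple_inv A : Y := [ffun l => symm_inv (A l)].

Lemma tuple_inv_pd A : tuple_pd A -> tuple_pd (tuple_inv A).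
Proof. by move=> Apd l; rewrite ffunE; exact: symm_inv_pd. Qed.

Lemma tuple_invK : involutive tuple_inv.
Proof. by move=> A; apply/ffunP => l; rewrite !ffunE symm_invK. Qed.

(** The traces in [symm_inv_monotone] are bounded so that [B] enters the modulus only through its
    distance to [A]. *)
Lemma tuple_inv_monotone A B : tuple_pd A -> tuple_pd B ->
  enorm (B - A) ^+ 2 <= p%:R * (1 + enorm A) ^+ 2 * (1 + enorm (B - A)) *
    dot (tuple_inv A - tuple_inv B) (B - A).
Proof.
move=> Apd Bpd; rewrite sqr_enorm !dot_ffun mulr_sumr; apply: ler_sum => l _.
rewrite !ffunE -sqr_enorm.
apply: le_trans (symm_inv_monotone (Apd l) (Bpd l)) _.
rewrite ler_wpM2r ?symm_inv_dot_ge0//.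
have e0 (u : Y) : 0 <= enorm u := enorm_ge0 u.
have BA : enorm B <= enorm A + enorm (B - A).
  by rewrite -{1}(subrK A B) addrC enormD.
have tA : \tr (A l) <= Num.sqrt p%:R * (1 + enorm A).
  apply: le_trans (symmx_tr_le _) _; rewrite ler_wpM2l ?sqrtr_ge0//.
  by apply: (le_trans (enorm_ffun A l)); rewrite lerDr.
have tB : \tr (B l) <= Num.sqrt p%:R * ((1 + enorm A) * (1 + enorm (B - A))).
  apply: le_trans (symmx_tr_le _) _; rewrite ler_wpM2l ?sqrtr_ge0//.
  apply: (le_trans (enorm_ffun B l)).
  by have := e0 A; have := e0 (B - A); nra.
have E (r a b : R) : r ^+ 2 * a ^+ 2 * b = (r * a) * (r * (a * b)) by ring.
rewrite -(@sqr_sqrtr R _ (ler0n R p)) E.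
by apply: ler_pM => //; apply/posdef_tr_ge0/pdmx_posdef.
Qed.

End Tuples.

Section LagrangianOperator.
Context (R : realType) (p L : nat) (lambda1 lambda2 : R).
Local Notation Y := 'Y[R]_(L, p).
Variable S : Y.
Local Notation T_L := (T_lagrangian lambda1 lambda2 S).
Local Notation P := (fused_reg lambda1 lambda2).

(** The subdifferential of [vartheta] at a positive definite [A] is the single point [- A^-1], so
    the inclusion for [Om] becomes an equation. *)
Lemma T_lagrangianE (Th Om X T U W : Y) :
  T_L (Th, Om, X) (T, U, W) <->
  [/\ subdifferential (fused_regE lambda1 lambda2) Th (T + X - S),
      tuple_pd Om, X - U = tuple_inv Om & W = Th - Om].
Proof.
rewrite T_lagrangianP; split=> [[HT HU ->]|[HT Opd XU ->]]; split=> //.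
- by move=> l; have [] := subdifferential_varthetaE (HU l).
- apply/ffunP => l; rewrite !ffunE.
  have [_ UX] := subdifferential_varthetaE (HU l).
  by rewrite -[LHS]opprB UX opprK.
- move=> l; have -> : U l - X l = - symm_inv (Om l).
    by have /ffunP/(_ l) := XU; rewrite !ffunE => <-; rewrite opprB.
  exact: subdifferential_vartheta.
Qed.

(** At step size 1, subtracting a proximal point from the argument of its proximal map leaves a
    subgradient. *)
Lemma KKT_T_lagrangian (Th Om X : Y) : 0 <= lambda1 -> 0 <= lambda2 ->
  KKT lambda1 lambda2 S (Th, Om, X) -> T_L (Th, Om, X) (0, 0, 0).
Proof.
move=> l1 l2 [HT HO TO]; rewrite T_lagrangianP; split=> //.
  have := prox_subdifferential ltr01 (fused_reg_convex l1 l2) (is_prox1 HT).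
  rewrite invr1 scale1r.
  suff -> : Th + X - S - Th = 0 + X - S by [].
  by rewrite add0r addrAC (addrAC Th) subrr add0r.
move=> l; have := prox_vartheta ltr01 (is_prox1 (HO l)).
rewrite invr1 scale1r ffunE.
suff -> : Om l - X l - Om l = 0 - X l by [].
by rewrite addrAC subrr.
Qed.

(** Sharper than monotonicity: the bilinear terms cancel, the regularizer contributes a nonnegative
    term that is dropped, and the log-determinant part is kept on the left. *)
Lemma T_lagrangian_monotone (Thb Omb Xb Th Om X T U W : Y) :
  T_L (Thb, Omb, Xb) (0, 0, 0) -> T_L (Th, Om, X) (T, U, W) ->
  dot (tuple_inv Omb - tuple_inv Om) (Om - Omb) <=
  dot T (Th - Thb) + dot U (Om - Omb) + dot W (X - Xb).
Proof.
move=> /T_lagrangianE[Pb pdb <- Wb] /T_lagrangianE[PT pdO <- ->].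
have := Pb Th; have := PT Thb; rewrite -!EFinD !lee_fin.
have -> : Thb = Omb by apply/eqP; rewrite -subr_eq0 -Wb.
rewrite subr0 add0r !(dotDl, dotNl, dotDr, dotNr) !(dotC _ X) !(dotC _ Xb); lra.
Qed.

End LagrangianOperator.

(** * Error bound and uniqueness at a KKT point *)

Section KKTPoint.
Context (R : realType) (p L : nat) (lambda1 lambda2 : R).
Local Notation Y := 'Y[R]_(L, p).
Variables (S Thb Omb Xb : Y).
Local Notation T_L := (T_lagrangian lambda1 lambda2 S).
Hypothesis T0 : T_L (Thb, Omb, Xb) (0, 0, 0).

Lemma tuple_inv_dot_ge0 (A B : Y) : tuple_pd A -> tuple_pd B ->
  0 <= dot (tuple_inv A - tuple_inv B) (B - A).
Proof.
move=> Apd Bpd; rewrite dot_ffun sumr_ge0// => l _; rewrite !ffunE.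
exact: symm_inv_dot_ge0.
Qed.

Lemma error_bound_exists :
  exists2 kappa, 0 <= kappa & error_bound lambda1 lambda2 S (Thb, Omb, Xb) kappa.
Proof.
have /T_lagrangianE[_ pdb] := T0; rewrite subr0 => Xinv Wb.
(* One constant for [tuple_inv_monotone] both at [Omb] and at its inverse [Xb]; the final 1 secures
   [1 <= C]. *)
pose C : R := p%:R * (1 + enorm Omb) ^+ 2 + p%:R * (1 + enorm Xb) ^+ 2 + 1.
have c1 : 0 <= p%:R * (1 + enorm Omb) ^+ 2 by rewrite mulr_ge0 ?sqr_ge0.
have c2 : 0 <= p%:R * (1 + enorm Xb) ^+ 2 by rewrite mulr_ge0 ?sqr_ge0.
have C1 : 1 <= C by rewrite /C; lra.
(* The total error is at most [2 e + 2 x + y], where [x] and [y] are at most [8 C e] once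
   [16 C e <= 1]. *)
exists (2 + 24 * C); first by lra.
exists (16 * C)^-1; first by rewrite invr_gt0; lra.
move=> [[Th Om] X] [[T U] W] TD De.
pose D : Y * Y * Y := (T, U, W); set e := enorm _ in De *.
have eT : enorm T <= e.
  by apply: le_trans (enorm_fst D); exact: (enorm_fst D.1).
have eU : enorm U <= e.
  by apply: le_trans (enorm_fst D); exact: (enorm_snd D.1).
have eW : enorm W <= e by exact: (enorm_snd D).
have /T_lagrangianE[_ pdO XU WE] := TD.
have e0 : 0 <= e := enorm_ge0 _.
set x := enorm (Om - Omb); set y := enorm (tuple_inv Om - tuple_inv Omb).
pose q := dot (tuple_inv Omb - tuple_inv Om) (Om - Omb).
have q0 : 0 <= q by exact: tuple_inv_dot_ge0.
have x0 : 0 <= x := enorm_ge0 _.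
have y0 : 0 <= y := enorm_ge0 _.
have Hx : x ^+ 2 <= C * (1 + x) * q.
  apply: le_trans (tuple_inv_monotone pdb pdO) _.
  by rewrite ler_wpM2r// ler_wpM2r ?addr_ge0// /C; lra.
(* Inversion is an involution, so the estimate between the inverses has the same factor [q]. *)
have Hy : y ^+ 2 <= C * (1 + y) * q.
  have := tuple_inv_monotone (tuple_inv_pd pdb) (tuple_inv_pd pdO).
  rewrite !tuple_invK -[in X in X -> _]Xinv Xinv => H; apply: (le_trans H).
  have -> : dot (Omb - Om) (tuple_inv Om - tuple_inv Omb) = q.
    by rewrite /q dotC -(opprB Om Omb) -(opprB (tuple_inv Om)) dotNr dotNl.
  by rewrite ler_wpM2r// ler_wpM2r ?addr_ge0// -Xinv /C; lra.
have Thd : enorm (Th - Thb) <= e + x.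
  have -> : Th - Thb = W + (Om - Omb).
    have -> : Thb = Omb by apply/eqP; rewrite -subr_eq0 -Wb.
    by rewrite WE addrA subrK.
  by apply: (le_trans (enormD _ _)); rewrite lerD2r.
have Xd : enorm (X - Xb) <= e + y.
  have -> : X - Xb = U + (tuple_inv Om - tuple_inv Omb).
    by rewrite -XU -Xinv addrA addrCA subrr addr0.
  by apply: (le_trans (enormD _ _)); rewrite lerD2r.
have Hq : q <= 2 * e ^+ 2 + 2 * e * x + e * y.
  apply: (le_trans (T_lagrangian_monotone T0 TD)).
  have h1 : dot T (Th - Thb) <= e * (e + x).
    by apply: (le_trans (dot_le_enorm _ _)); rewrite ler_pM ?enorm_ge0.
  have h2 : dot U (Om - Omb) <= e * x.
    by apply: (le_trans (dot_le_enorm _ _)); rewrite ler_pM ?enorm_ge0.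
  have h3 : dot W (X - Xb) <= e * (e + y).
    by apply: (le_trans (dot_le_enorm _ _)); rewrite ler_pM ?enorm_ge0.
  by move: h1 h2 h3; rewrite !mulrDr; lra.
have Ce : 16 * C * e <= 1.
  by move: De; rewrite -[_^-1]div1r ler_pdivlMr ?mulr_gt0//; lra.
have [xe ye] := quadratic_growth_bound C1 e0 Ce x0 y0 Hx Hy Hq.
apply: le_trans (enorm_pair_le _) _.
apply: (@le_trans _ _ (e + x + x + (e + y))).
  by apply: lerD => //; apply: le_trans (enorm_pair_le _) _; apply: lerD.
by rewrite mulrDl; lra.
Qed.

Lemma T_lagrangian_zero_unique (Th Om X : Y) :
  T_L (Th, Om, X) (0, 0, 0) -> (Th, Om, X) = (Thb, Omb, Xb).
Proof.
move=> T1; have [kappa _ [rho rho0 /(_ _ _ T1)]] := error_bound_exists.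
rewrite enorm0 mulr0 (ltW rho0) => /(_ isT) H.
apply/eqP; rewrite -subr_eq0; apply/eqP/enorm_eq0/eqP.
by rewrite eq_le H enorm_ge0.
Qed.

(** Strict concavity of the sum: the gaps are nonnegative with sum at most zero, so each vanishes
    and [lndet_eq] applies. *)
Lemma lndet_gap_eq (A B : Y) : tuple_pd A -> tuple_pd B ->
  \sum_l ln (\det (A l)) + dot (tuple_inv A) (B - A) <= \sum_l ln (\det (B l)) ->
  B = A.
Proof.
move=> Apd Bpd; pose gap l := ln (\det (A l)) + dot (symm_inv (A l)) (B l - A l)
  - ln (\det (B l)).
have gap0 l : 0 <= gap l by rewrite subr_ge0 lndet_le.
move=> AB.
have : \sum_l gap l == 0.
  rewrite eq_le sumr_ge0// andbT /gap sumrB big_split /= subr_le0.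
  suff -> : \sum_l dot (symm_inv (A l)) (B l - A l) = dot (tuple_inv A) (B - A) by [].
  by rewrite dot_ffun; apply: eq_bigr => l _; rewrite !ffunE.
rewrite psumr_eq0// => /allP g; apply/ffunP => l.
apply: lndet_eq => //; have := g l (mem_index_enum l).
by rewrite /= subr_eq0 => /eqP ->.
Qed.

Lemma sum_vartheta (A : Y) : tuple_pd A ->
  (\sum_l vartheta (A l) = (- \sum_l ln (\det (A l)))%:E)%E.
Proof.
by move=> Apd; rewrite -sumrN -sumEFin; apply: eq_bigr => l _; rewrite varthetaE.
Qed.

Lemma sum_vartheta_fin (A : Y) : (\sum_l vartheta (A l) < +oo)%E -> tuple_pd A.
Proof.
move=> Afin l; apply: vartheta_fin; apply: contraTneq Afin => Aoo.
rewrite -leNgt leye_eq; apply/eqP/esum_eqyP; last by exists l.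
by move=> i _; rewrite -ltNye var_gtN.
Qed.

Lemma lagrangian_feasible (Th Om X : Y) : Th - Om = 0 ->
  lagrangian lambda1 lambda2 S Th Om X = primal_obj lambda1 lambda2 S Th Om.
Proof. by move=> TO; rewrite /lagrangian TO dotC dot0r sube0. Qed.

(** At feasible points the Lagrangian equals the objective, so its zero subgradient gives
    optimality. For another minimizer, the subgradient inequality of the regularizer leaves a
    log-determinant gap that is at most zero. *)
Lemma primal_solutionsE : primal_solutions lambda1 lambda2 S = [set (Thb, Omb)].
Proof.
have /T_lagrangianE[Pb pdb Xinv Wb] := T0.
have opt (z : Y * Y) : z.1 - z.2 = 0 ->
    (primal_obj lambda1 lambda2 S Thb Omb <= primal_obj lambda1 lambda2 S z.1 z.2)%E.
  move=> z0; have [H _] := T0; have := H z.1 z.2.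
  by rewrite !dot0l addr0 adde0 !lagrangian_feasible.
apply/seteqP; split=> [[Th Om] [/= TO Omin]|_ ->]; last by split=> //; rewrite -Wb.
have Omb_Thb : Omb = Thb by apply/esym/eqP; rewrite -subr_eq0 -Wb.
have Om_Th : Om = Th by apply/esym/eqP; rewrite -subr_eq0 TO.
have /= := Omin (Thb, Omb) (esym Wb).
rewrite -!(@lagrangian_feasible _ _ Xb)// !lagrE -Wb TO (sum_vartheta pdb) !dot0l !subr0.
rewrite -EFinD => H.
have pdO : tuple_pd Om.
  apply: sum_vartheta_fin; rewrite ltNge; apply/negP; rewrite leye_eq => /eqP Ooo.
  by move: H; rewrite Ooo addye// leye_eq.
move: H; rewrite sum_vartheta// -EFinD lee_fin => H.
suff OmE : Om = Omb by rewrite -Om_Th OmE -Omb_Thb.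
apply: lndet_gap_eq => //; rewrite -Xinv subr0.
have := Pb Th; rewrite -EFinD lee_fin add0r dotBl !dotBr.
move: H; rewrite Om_Th Omb_Thb; lra.
Qed.

Lemma sum_lndet_le (A B : Y) : tuple_pd A -> tuple_pd B ->
  \sum_l ln (\det (B l)) <= \sum_l ln (\det (A l)) + dot (tuple_inv A) (B - A).
Proof.
move=> Apd Bpd; rewrite dot_ffun -big_split; apply: ler_sum => l _.
by rewrite !ffunE; exact: lndet_le.
Qed.

(** The conjugate is bounded below by the single term of its supremum at [Thb], exactly at [Xb - S].
    So [val] majorizes the dual objective on positive definite tuples, agrees with it at [Xb], and
    is maximal only there because the inverse of [Xb] is [Thb]. *)
Lemma dual_solutionsE : dual_solutions lambda1 lambda2 S = [set Xb].
Proof.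
have /T_lagrangianE[Pb pdb] := T0; rewrite subr0 add0r in Pb * => Xinv Wb.
have Omb_Thb : Omb = Thb by apply/esym/eqP; rewrite -subr_eq0 -Wb.
have pdX : tuple_pd Xb by rewrite Xinv; exact: tuple_inv_pd.
have invX : tuple_inv Xb = Thb by rewrite Xinv tuple_invK.
pose val (X : Y) : R := \sum_(l < L) (ln (\det (X l)) + p%:R) -
  (dot (X - S) Thb - fused_reg lambda1 lambda2 Thb).
have conj_ge (V : Y) : ((dot V Thb - fused_reg lambda1 lambda2 Thb)%:E <=
    conjugate (fused_regE lambda1 lambda2) V)%E.
  by apply: ereal_sup_ubound; exists Thb => //; rewrite /fused_regE -EFinB.
have conjb : conjugate (fused_regE lambda1 lambda2) (Xb - S) =
    (dot (Xb - S) Thb - fused_reg lambda1 lambda2 Thb)%:E.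
  apply/eqP; rewrite eq_le conj_ge andbT; apply: ub_ereal_sup => _ [T _ <-].
  have := Pb T; rewrite /fused_regE -EFinD -EFinB !lee_fin dotBr; lra.
have sumE (X : Y) : tuple_pd X -> (\sum_(l < L) (- vartheta (X l) + p%:R%:E) =
    (\sum_(l < L) (ln (\det (X l)) + p%:R))%:E)%E.
  move=> Xpd; rewrite -sumEFin; apply: eq_bigr => l _.
  by rewrite varthetaE// -EFinN opprK -EFinD.
have dual_le (X : Y) : tuple_pd X ->
    (dual_obj lambda1 lambda2 S X <= (val X)%:E)%E.
  by move=> Xpd; rewrite /dual_obj sumE// EFinB leeB.
have dualb : dual_obj lambda1 lambda2 S Xb = (val Xb)%:E.
  by rewrite /dual_obj sumE// conjb -EFinB.
have dual_pd (X : Y) : (dual_obj lambda1 lambda2 S X != -oo)%E -> tuple_pd X.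
  move=> Xfin l; apply: vartheta_fin; apply: contraNneq Xfin => Xoo.
  rewrite /dual_obj (_ : (\sum_(l < L) _ = -oo)%E) ?addNye//.
  by apply/esum_eqNyP; exists l; rewrite Xoo.
have val_le (X : Y) : \sum_l ln (\det (X l)) - dot Thb X <=
    \sum_l ln (\det (Xb l)) - dot Thb Xb -> val X <= val Xb.
  by rewrite /val !big_split /= !dotBl !(dotC _ Thb); lra.
apply/seteqP; split=> [X [_ Xmax]|_ ->].
  have := Xmax Xb I; rewrite dualb => H.
  have Xpd : tuple_pd X.
    by apply: dual_pd; apply: contraTneq H => ->; rewrite leeNy_eq.
  have := le_trans H (dual_le _ Xpd); rewrite lee_fin /val !big_split /= => {}H.
  apply: lndet_gap_eq => //; rewrite invX dotBr.
  by move: H; rewrite !dotBl !(dotC _ Thb); lra.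
split=> // X _; rewrite dualb.
have [/eqP ->|Xfin] := boolP (dual_obj lambda1 lambda2 S X == -oo%E).
  exact: leNye.
have Xpd := dual_pd _ Xfin; apply: (le_trans (dual_le _ Xpd)).
rewrite lee_fin; apply: val_le; have := sum_lndet_le pdX Xpd.
by rewrite invX dotBr; lra.
Qed.

End KKTPoint.

(** * The algorithm *)

Lemma sqr_cvg0 (R : realType) (b : R^nat) : (forall k, 0 <= b k) ->
  (fun k => b k ^+ 2) @ \oo --> (0 : R) -> b @ \oo --> (0 : R).
Proof.
move=> b0 b2; rewrite (_ : b = fun k => Num.sqrt (b k ^+ 2)); last first.
  by apply/funext => k; rewrite sqrtr_sqr ger0_norm.
by rewrite -(@sqrtr0 R); apply: continuous_cvg => //; exact: sqrt_continuous.
Qed.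

(** As [a] and [eps] are bounded, expanding the square gives [b k ^+ 2 <= a k ^+ 2 - a k.+1 ^+ 2 + K
    * eps k]; telescoping makes the series of squares converge. *)
Lemma quasi_fejer_cvg0 (R : realType) (a b eps : R^nat) :
  (forall k, 0 <= a k) -> (forall k, 0 <= b k) -> (forall k, 0 <= eps k) ->
  cvgn (series eps) ->
  (forall k, a k.+1 ^+ 2 + b k ^+ 2 <= (a k + eps k) ^+ 2) ->
  b @ \oo --> (0 : R).
Proof.
move=> a0 b0 eps0 epscvg ab.
have nd (u : R^nat) : (forall k, 0 <= u k) ->
    {homo series u : n m / (n <= m)%N >-> n <= m}.
  move=> u0; apply/nondecreasing_seqP => n.
  by rewrite seriesS lerDr.
pose E := limn (series eps).
have sE n : series eps n <= E := nondecreasing_cvgn_le (nd _ eps0) epscvg n.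
have E0 : 0 <= E.
  by apply: le_trans (sE 0%N); rewrite /series /= big_geq.
have epsE k : eps k <= E.
  apply: le_trans (sE k.+1); rewrite seriesS lerDl.
  by rewrite /series /= sumr_ge0.
have aS k : a k.+1 <= a k + eps k.
  rewrite -(@ler_pXn2r _ 2) ?nnegrE ?addr_ge0//.
  by apply: le_trans (ab k); rewrite lerDl sqr_ge0.
have aM k : a k <= a 0%N + series eps k.
  elim: k => [|k IH]; first by rewrite /series /= big_geq// addr0.
  by apply: (le_trans (aS k)); rewrite seriesS addrCA addrC lerD2r.
pose K := 2 * (a 0%N + E) + E.
have bS k : b k ^+ 2 <= a k ^+ 2 - a k.+1 ^+ 2 + K * eps k.
  have h1 : (2 * a k + eps k) * eps k <= K * eps k.
    rewrite ler_wpM2r// /K; have := aM k; have := sE k; have := epsE k; lra.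
  have := ab k; rewrite sqrrD mulr2n; move: h1; rewrite mulrDl; lra.
have b2S n : series (fun k => b k ^+ 2) n <= a 0%N ^+ 2 - a n ^+ 2 + K * series eps n.
  elim: n => [|n IH]; first by rewrite /series /= !big_geq// mulr0 addr0 subrr.
  by rewrite !seriesS mulrDr; have := bS n; lra.
apply: sqr_cvg0 => //; apply: cvg_series_cvg_0.
apply: nondecreasing_is_cvgn; first by apply: nd => k; rewrite sqr_ge0.
exists (a 0%N ^+ 2 + K * E) => _ [n _ <-].
apply: (le_trans (b2S n)).
have : K * series eps n <= K * E by rewrite ler_wpM2l// /K; have := a0 0%N; lra.
by have := sqr_ge0 (a n); lra.
Qed.

Lemma gradient_majorant (R : realType) (V : innerType R) (g : V -> \bar R)
    (x G G0 : V) (a : R) :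
  g x = a%:E -> (forall h, (g (x + h)%R <= (a + dot G0 h)%:E)%E) ->
  is_gradient g x G -> G = G0.
Proof.
move=> gx gle Ggrad; apply/eqP; rewrite -subr_eq0; apply/eqP/enorm_eq0/eqP.
set n := enorm (G - G0); apply/negPn/negP => n0.
have {}n0 : 0 < n by rewrite lt_neqAle eq_sym n0 enorm_ge0.
have [d d0 dP] := Ggrad (n / 2) (divr_gt0 n0 (ltr0Sn _ 1)).
have t0 : 0 < d / n by rewrite divr_gt0.
(* This step has length [d]; on it the two linear terms differ by [d * n], while the tolerance is
   [n / 2 * d]. *)
have := dP ((d / n) *: (G - G0)); rewrite enormZ gtr0_norm// -/n divfK ?gt_eqF//.
rewrite lexx => /(_ isT); have := gle ((d / n) *: (G - G0)); rewrite gx.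
case: (g _) => [r| |] //=; rewrite lee_fin => H.
apply/negP; rewrite lee_fin -ltNge.
rewrite -normrN; apply: lt_le_trans (ler_norm _).
have : dot G ((d / n) *: (G - G0)) - dot G0 ((d / n) *: (G - G0)) = d * n.
  rewrite -dotBl dotZr -sqr_enorm -/n expr2 mulrA divfK ?gt_eqF//.
by have := mulr_gt0 d0 n0; lra.
Qed.

Section Algorithm.
Context (R : realType) (p L : nat) (lambda1 lambda2 : R).
Local Notation Y := 'Y[R]_(L, p).
Variables (S : Y) (sigma : R^nat) (Theta Omega X : nat -> Y).
Hypotheses (l1 : 0 <= lambda1) (l2 : 0 <= lambda2).
Hypothesis sigma_gt0 : forall k, 0 < sigma k.
Hypothesis run : rPPA lambda1 lambda2 S sigma Theta Omega X.
Local Notation T_L := (T_lagrangian lambda1 lambda2 S).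

Definition rPPA_residual k : Y * Y * Y :=
  ((sigma k)^-1 *: (Theta k - Theta k.+1),
   (sigma k)^-1 *: (Omega k - Omega k.+1), Theta k.+1 - Omega k.+1).

Definition Phi_hat_gradient k : Y :=
  - (Theta k.+1 - Omega k.+1) - (sigma k)^-1 *: (X k.+1 - X k).

Lemma rPPA_residualP k :
  T_L (Theta k.+1, Omega k.+1, X k.+1) (rPPA_residual k).
Proof.
have s0 := sigma_gt0 k; have sN0 : sigma k != 0 by rewrite gt_eqF.
apply/T_lagrangianP; split=> //.
  have := prox_subdifferential s0 (fused_reg_convex l1 l2) (rPPA_Theta run k).
  suff -> : (sigma k)^-1 *: (Theta k + sigma k *: (X k.+1 - S) - Theta k.+1) =
    (sigma k)^-1 *: (Theta k - Theta k.+1) + X k.+1 - S by [].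
  by rewrite addrAC scalerDr scalerA mulVf// scale1r addrA.
move=> l; have := prox_vartheta s0 (rPPA_Omega run k l).
rewrite !ffunE.
suff -> : (sigma k)^-1 *: (Omega k l - sigma k *: X k.+1 l - Omega k.+1 l) =
  (sigma k)^-1 *: (Omega k l - Omega k.+1 l) - X k.+1 l by [].
by rewrite addrAC scalerBr scalerA mulVf// scale1r.
Qed.

(* Phi_hat is the infimum over (Theta, Omega) of functions concave in X, attained
   at the iterates of Step 2; dropping the infimum leaves a smooth majorant that
   touches Phi_hat at X k.+1, so their gradients coincide there. *)
Lemma Phi_hat_gradientE k G :
  is_gradient (Phi_hat lambda1 lambda2 S sigma Theta Omega X k) (X k.+1) G ->
  G = Phi_hat_gradient k.
Proof.
set s := sigma k; have s0 : 0 < s := sigma_gt0 k.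
set Th := Theta k.+1; set Om := Omega k.+1.
pose quad (z : Y * Y) : R := (2 * s)^-1 *
  (enorm (z.1 - Theta k) ^+ 2 + enorm (z.2 - Omega k) ^+ 2).
have Tres := rPPA_residualP k.
have /T_lagrangianE[_ pdO _ _] := Tres.
pose r Z := - (\sum_(l < L) ln (\det (Om l))) +
  (dot S Th + fused_reg lambda1 lambda2 Th - dot (Th - Om) Z).
have lagr Z : lagrangian lambda1 lambda2 S Th Om Z = (r Z)%:E.
  by rewrite lagrE sum_vartheta// -EFinD.
have PhiX : Phi lambda1 lambda2 S sigma Theta Omega k (X k.+1) =
    (r (X k.+1) + quad (Th, Om))%:E.
  apply/eqP; rewrite eq_le; apply/andP; split.
    by apply: ereal_inf_lbound; exists (Th, Om) => //=; rewrite lagr -EFinD.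
  (* The subgradient term [tu] of the Lagrangian cancels the linear term of the quadratic expanded
     around the new iterates. *)
  apply: le_ereal_inf_tmp => _ [z _ <-].
  have [+ _] := Tres => /(_ z.1 z.2); rewrite lagr -EFinD.
  set tu := dot _ (z.1 - _) + _; move=> H.
  have -> : r (X k.+1) + quad (Th, Om) = r (X k.+1) + tu + (quad (Th, Om) - tu).
    by lra.
  rewrite EFinD; apply: leeD => //; rewrite lee_fin -/(quad z).
  rewrite /quad (sqr_enorm_shift (Theta k) Th z.1) (sqr_enorm_shift (Omega k) Om z.2).
  rewrite /tu !dotZl -(opprB Th (Theta k)) -(opprB Om (Omega k)) !dotNl.
  rewrite invfM; have i0 : 0 < s^-1 by rewrite invr_gt0.
  have := mulr_ge0 (ltW i0) (sqr_ge0 (enorm (z.1 - Th))).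
  have := mulr_ge0 (ltW i0) (sqr_ge0 (enorm (z.2 - Om))).
  by rewrite /= -/s !(mulrDr, mulrN); lra.
have Phi_le Z : (Phi lambda1 lambda2 S sigma Theta Omega k Z <=
    (r Z + quad (Th, Om))%:E)%E.
  by apply: ereal_inf_lbound; exists (Th, Om) => //=; rewrite lagr -EFinD.
apply: (@gradient_majorant _ _ _ _ _ _
  (r (X k.+1) + quad (Th, Om) - (2 * s)^-1 * enorm (X k.+1 - X k) ^+ 2)).
  by rewrite /Phi_hat PhiX -EFinB.
move=> h; apply: (@le_trans _ _
  (r (X k.+1 + h) + quad (Th, Om) - (2 * s)^-1 * enorm (X k.+1 + h - X k) ^+ 2)%:E).
  by rewrite EFinB; apply: leeB => //; exact: Phi_le.
(* Expanding the square and dropping its term in [enorm h ^+ 2] leaves an affine majorant of slope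
   [Phi_hat_gradient k]. *)
rewrite lee_fin (addrAC (X k.+1)) (sqr_enormD (X k.+1 - X k) h).
rewrite /r /Phi_hat_gradient -/Th -/Om; move: (Th - Om) => W.
rewrite (dotDr W) (dotBl (- W)) (dotNl W) (dotZl (sigma k)^-1) -/s.
have := mulr_ge0 (ltW (_ : 0 < s^-1)) (sqr_ge0 (enorm h)).
rewrite invr_gt0 => /(_ s0); rewrite invfM !(mulrDr, mulrN); lra.
Qed.

Definition rPPA_shifted k : Y * Y * Y :=
  (Theta k, Omega k, X k.+1 + sigma k *: (Theta k.+1 - Omega k.+1)).

Local Notation z k := (Theta k, Omega k, X k).

(* The shifted point is z^{k+1} + sigma_k D with D the residual, so z^{k+1} is
   the exact resolvent step from it. *)
Lemma rPPA_shiftedE k : rPPA_shifted k - z k.+1 = sigma k *: rPPA_residual k.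
Proof.
have sN0 : sigma k != 0 by rewrite gt_eqF.
rewrite /rPPA_shifted /rPPA_residual; congr (_, _, _) => /=.
- by rewrite scalerA mulfV// scale1r.
- by rewrite scalerA mulfV// scale1r.
- by rewrite addrC addKr.
Qed.

(** The shifted point differs from the current iterate only in the multiplier, by [- sigma k *: G].
    Both criteria fit, with [c] equal to [eps k] or to [delta k] times the step length. *)
Lemma rPPA_shifted_dist k (zb : Y * Y * Y) (c : R) :
  gradient_norm_le (Phi_hat lambda1 lambda2 S sigma Theta Omega X k) (X k.+1)
    (c / sigma k) ->
  enorm (rPPA_shifted k - zb) <= enorm (z k - zb) + c.
Proof.
move=> [G /Phi_hat_gradientE GE Gc].
apply: (le_trans (enormDB _ (z k) _)); rewrite addrC lerD2l.
have -> : rPPA_shifted k - z k = (0, 0, - (sigma k *: G)).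
  congr (_, _, _) => /=; rewrite ?subrr// GE /Phi_hat_gradient.
  move: (Theta k.+1 - Omega k.+1) => W.
  rewrite scalerBr scalerN scalerA mulfV ?gt_eqF// scale1r.
  by rewrite opprB opprK addrAC.
apply: (le_trans (enorm_pair_le _)) => /=.
apply: (@le_trans _ _ (enorm (- (sigma k *: G)))); last first.
  by rewrite enormN enormZ gtr0_norm// mulrC -ler_pdivlMr.
by rewrite -[leRHS]add0r lerD2r (_ : (0, 0) = 0) ?enorm0.
Qed.

Variables (Thb Omb Xb : Y).
Hypothesis T0 : T_L (Thb, Omb, Xb) (0, 0, 0).
Local Notation zb := (Thb, Omb, Xb).

(** Expand the square around the new iterate: the cross term is nonnegative by monotonicity of the
    operator. *)
Lemma rPPA_descent k :
  enorm (z k.+1 - zb) ^+ 2 + enorm (sigma k *: rPPA_residual k) ^+ 2 <=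
  enorm (rPPA_shifted k - zb) ^+ 2.
Proof.
rewrite -rPPA_shiftedE (sqr_enorm_shift zb (z k.+1) (rPPA_shifted k)).
rewrite rPPA_shiftedE dotZr dotC.
have /T_lagrangianE[_ pdb _ _] := T0.
have /T_lagrangianE[_ pdO _ _] := rPPA_residualP k.
have mono := T_lagrangian_monotone T0 (rPPA_residualP k).
have : 0 <= dot (rPPA_residual k) (z k.+1 - zb).
  by apply: le_trans mono; exact: tuple_inv_dot_ge0.
by move=> /(mulr_ge0 (ltW (sigma_gt0 k))); lra.
Qed.

End Algorithm.

(** * The contraction factor and its limit *)

Section Rate.
Context (R : realType).

Definition contraction_factor (kappa s : R) : R :=
  kappa * (Num.sqrt (kappa ^+ 2 + s ^+ 2))^-1.

Lemma contraction_factor_lt1 (kappa s : R) : 0 <= kappa -> 0 < s ->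
  contraction_factor kappa s < 1.
Proof.
move=> k0 s0; have ks : 0 < kappa ^+ 2 + s ^+ 2.
  by rewrite ltr_wpDl ?sqr_ge0// exprn_gt0.
rewrite /contraction_factor ltr_pdivrMr ?sqrtr_gt0// mul1r.
rewrite -[ltLHS](ger0_norm k0) -sqrtr_sqr ltr_sqrt//.
by rewrite ltrDl exprn_gt0.
Qed.

Lemma contraction_factor_ge0 (kappa s : R) : 0 <= kappa ->
  0 <= contraction_factor kappa s.
Proof. by move=> k0; rewrite mulr_ge0// invr_ge0 sqrtr_ge0. Qed.

(** Eliminate [d]: [s^2 a^2 <= kappa^2 (s d)^2 <= kappa^2 (w^2 - a^2)]. *)
Lemma contraction_factor_bound (kappa s a d w : R) : 0 <= kappa -> 0 < s ->
  0 <= a -> 0 <= d -> 0 <= w ->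
  a <= kappa * d -> a ^+ 2 + (s * d) ^+ 2 <= w ^+ 2 ->
  a <= contraction_factor kappa s * w.
Proof.
move=> k0 s0 a0 d0 w0 ad aw; have ks : 0 < kappa ^+ 2 + s ^+ 2.
  by rewrite ltr_wpDl ?sqr_ge0// exprn_gt0.
rewrite /contraction_factor mulrAC ler_pdivlMr ?sqrtr_gt0//.
rewrite -(@ler_pXn2r _ 2) ?nnegrE ?mulr_ge0 ?sqrtr_ge0//.
rewrite exprMn sqr_sqrtr ?(ltW ks)//.
have h1 : a ^+ 2 <= (kappa * d) ^+ 2 by rewrite ler_pXn2r ?nnegrE// mulr_ge0.
have h2 : s ^+ 2 * a ^+ 2 <= s ^+ 2 * (kappa * d) ^+ 2 by rewrite ler_wpM2l ?sqr_ge0.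
have h3 : kappa ^+ 2 * (a ^+ 2 + (s * d) ^+ 2) <= kappa ^+ 2 * w ^+ 2.
  by rewrite ler_wpM2l ?sqr_ge0.
move: h2 h3; rewrite !exprMn !mulrDr !(mulrA _ _ (d ^+ 2)).
by rewrite (mulrC (s ^+ 2) (kappa ^+ 2)); lra.
Qed.

Variables (sigma : R^nat) (sigma_oo : \bar R) (kappa : R).
Hypotheses (sigma_gt0 : forall k, 0 < sigma k)
  (sigma_nd : {homo sigma : k m / (k <= m)%N >-> k <= m})
  (sigma_cvg : (fun k => (sigma k)%:E) @ \oo --> sigma_oo)
  (kappa0 : 0 <= kappa).

(** Positivity of the terms excludes the limit [-oo], and monotonicity keeps a finite limit above
    [sigma 0]; the limit denominator is then nonzero even for [kappa = 0]. *)
Lemma sigma_limit_gt0 : (0 < sigma_oo)%E.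
Proof.
case: sigma_oo sigma_cvg => [s /fine_cvg sc||/cvgeNy_lt/(_ 0)[N _ /(_ N (leqnn N))]].
- rewrite lte_fin; apply: (lt_le_trans (sigma_gt0 0)).
  by apply: (cvgr_to_ge sc); near=> k; exact: sigma_nd.
- by rewrite ltry.
- by rewrite /= lte_fin ltNge ltW.
Unshelve. all: by end_near. Qed.

Lemma contraction_factor_cvg :
  (fun k => contraction_factor kappa (sigma k)) @ \oo --> rate_limit kappa sigma_oo.
Proof.
have := sigma_limit_gt0; case: sigma_oo sigma_cvg => [s /fine_cvg sc|sc|]//= s0.
- rewrite lte_fin in s0.
  have ks : 0 < kappa ^+ 2 + s ^+ 2.
    by rewrite ltr_wpDl ?sqr_ge0// exprn_gt0.
  apply: cvgM; first exact: cvg_cst.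
  apply: cvgV; first by rewrite gt_eqF// sqrtr_gt0.
  apply: continuous_cvg; first exact: sqrt_continuous.
  apply: cvgD; first exact: cvg_cst.
  by rewrite !expr2; under eq_fun do rewrite expr2; exact: cvgM.
(* For an infinite limit, the factor lies between 0 and [kappa / sigma k]. *)
- apply: (@squeeze_cvgr _ _ _ _ (fun=> 0) (fun k => kappa * (sigma k)^-1)).
  + near=> k; rewrite contraction_factor_ge0//= ler_wpM2l// lef_pV2 ?posrE ?sqrtr_gt0//.
      rewrite -[leLHS]gtr0_norm// -sqrtr_sqr ler_wsqrtr// lerDr sqr_ge0//.
    by rewrite ltr_wpDl ?sqr_ge0// exprn_gt0.
  + exact: cvg_cst.
  + rewrite -(mulr0 kappa); apply: cvgM; first exact: cvg_cst.
    apply/gtr0_cvgV0; first by near=> k.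
    exact/cvgeryP.
Unshelve. all: by end_near. Qed.

Lemma rate_limit_lt1 : rate_limit kappa sigma_oo < 1.
Proof.
have := sigma_limit_gt0; case: sigma_oo => [s||]//= s0.
exact: contraction_factor_lt1.
Qed.

Lemma rate_cvg (delta : R^nat) : cvgn (series delta) ->
  (fun k => rate kappa (sigma k) (delta k)) @ \oo --> rate_limit kappa sigma_oo.
Proof.
move=> /cvg_series_cvg_0 d0.
have -> : rate_limit kappa sigma_oo = (rate_limit kappa sigma_oo + 0) / (1 - 0).
  by rewrite addr0 subr0 divr1.
apply: cvgM; first by apply: cvgD => //; exact: contraction_factor_cvg.
apply: cvgV; first by rewrite subr0 oner_eq0.
by apply: cvgB => //; exact: cvg_cst.
Qed.

End Rate.

(** * Convergence and rate of the iterates *)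

Section Convergence.
Context (R : realType) (p L : nat) (lambda1 lambda2 : R).
Local Notation Y := 'Y[R]_(L, p).
Variables (S : Y) (sigma : R^nat) (sigma_oo : \bar R) (Theta Omega X : nat -> Y).
Hypotheses (l1 : 0 <= lambda1) (l2 : 0 <= lambda2).
Hypotheses (sigma_gt0 : forall k, 0 < sigma k)
  (sigma_nd : {homo sigma : k m / (k <= m)%N >-> k <= m})
  (sigma_cvg : (fun k => (sigma k)%:E) @ \oo --> sigma_oo).
Hypothesis run : rPPA lambda1 lambda2 S sigma Theta Omega X.
Local Notation T_L := (T_lagrangian lambda1 lambda2 S).
Variables (Thb Omb Xb : Y).
Hypothesis T0 : T_L (Thb, Omb, Xb) (0, 0, 0).
Variable eps : R^nat.
Hypothesis A : critA lambda1 lambda2 S sigma Theta Omega X eps.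
Local Notation z k := (Theta k, Omega k, X k).
Local Notation zb := (Thb, Omb, Xb).
Local Notation D k := (rPPA_residual sigma Theta Omega k).

(** [quasi_fejer_cvg0] makes [sigma k *: D k] vanish, and [sigma k >= sigma 0 > 0] transfers this to
    [D k]. *)
Lemma rPPA_residual_cvg0 : (fun k => enorm (D k)) @ \oo --> (0 : R).
Proof.
have [eps0 epscvg epsG] := A.
have bcvg : (fun k => enorm (sigma k *: D k)) @ \oo --> (0 : R).
  apply: (@quasi_fejer_cvg0 _ (fun k => enorm (z k - zb)) _ eps) => // [k|k|k].
  - exact: enorm_ge0.
  - exact: enorm_ge0.
  apply: (le_trans (rPPA_descent l1 l2 sigma_gt0 run T0 k)).
  rewrite ler_pXn2r ?nnegrE ?addr_ge0 ?enorm_ge0//.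
  exact: (rPPA_shifted_dist l1 l2 sigma_gt0 run zb (epsG k)).
apply: (@squeeze_cvgr _ _ _ _ (fun=> 0)
  (fun k => (sigma 0%N)^-1 * enorm (sigma k *: D k))).
- near=> k; rewrite enorm_ge0 /= ler_pdivlMl// enormZ gtr0_norm//.
  by rewrite ler_wpM2r ?enorm_ge0// sigma_nd.
- exact: cvg_cst.
- by rewrite -(mulr0 (sigma 0%N)^-1); apply: cvgM => //; exact: cvg_cst.
Unshelve. all: by end_near. Qed.

Lemma rPPA_error_near kappa : error_bound lambda1 lambda2 S zb kappa ->
  \forall k \near \oo, enorm (z k.+1 - zb) <= kappa * enorm (D k).
Proof.
move=> [rho rho0 eb].
apply: filterS (cvgr_le _ rPPA_residual_cvg0 _ rho0) => k.
exact: eb (rPPA_residualP l1 l2 sigma_gt0 run k).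
Qed.

(** The error bound controls the whole sequence by residuals, so no cluster points are extracted;
    the index shifts because [D k] belongs to the iterate [k.+1]. *)
Lemma rPPA_cvg : (fun k => enorm (z k - zb)) @ \oo --> (0 : R).
Proof.
have [kappa kappa0 eb] := error_bound_exists T0.
rewrite -cvg_shiftS.
apply: (@squeeze_cvgr _ _ _ _ (fun=> 0) (fun k => kappa * enorm (D k))).
- by near=> k; rewrite enorm_ge0 /=; near: k; exact: rPPA_error_near.
- exact: cvg_cst.
- rewrite -(mulr0 kappa); apply: cvgM; first exact: cvg_cst.
  exact: rPPA_residual_cvg0.
Unshelve. all: by end_near. Qed.

Lemma rPPA_rate delta kappa :
  critB lambda1 lambda2 S sigma Theta Omega X delta -> 0 <= kappa ->
  error_bound lambda1 lambda2 S zb kappa ->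
  \forall k \near \oo, enorm (z k.+1 - zb) <=
    rate kappa (sigma k) (delta k) * enorm (z k - zb).
Proof.
move=> [d0 dcvg dG] kappa0 eb.
near=> k.
have d1 : delta k < 1.
  near: k; exact: (cvgr_lt _ (cvg_series_cvg_0 dcvg) _ ltr01).
have aD : enorm (z k.+1 - zb) <= kappa * enorm (D k).
  by near: k; exact: rPPA_error_near.
have := contraction_factor_bound kappa0 (sigma_gt0 k) (enorm_ge0 _) (enorm_ge0 _)
  (enorm_ge0 (rPPA_shifted sigma Theta Omega X k - zb)) aD.
have -> : sigma k * enorm (D k) = enorm (sigma k *: D k).
  by rewrite enormZ gtr0_norm.
move=> /(_ (rPPA_descent l1 l2 sigma_gt0 run T0 k)).
have := rPPA_shifted_dist l1 l2 sigma_gt0 run zb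
  (c := delta k * enorm ((Theta k.+1, Omega k.+1) - (Theta k, Omega k))).
move=> /(_ k); rewrite mulrAC => /(_ (dG k)).
set w := enorm (rPPA_shifted _ _ _ _ k - zb).
set step := enorm (_ - (Theta k, Omega k)).
have stepE : step <= enorm (z k.+1 - zb) + enorm (z k - zb).
  rewrite (enormBC (z k)); apply: le_trans (enormDB _ _ _).
  exact: (enorm_fst (z k.+1 - z k)).
move=> wa a'w.
rewrite /rate -/(contraction_factor kappa (sigma k)) mulrAC ler_pdivlMr ?subr_gt0//.
have := contraction_factor_lt1 kappa0 (sigma_gt0 k).
have := contraction_factor_ge0 (sigma k) kappa0.
have := enorm_ge0 (z k - zb); have := enorm_ge0 (z k.+1 - zb).
move: (contraction_factor _ _) (d0 k) stepE wa a'w.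
move: (enorm (z k.+1 - zb)) (enorm (z k - zb)) (delta k) => a' a d t.
move=> dge0 sE wa a'w a'0 a0 t0 t1.
(* From [a' <= t w], [w <= a + d step], [step <= a' + a] and [t < 1] follows
   [(1 - d) a' <= (t + d) a]. *)
have h1 : d * step <= d * (a' + a) by rewrite ler_wpM2l.
have h2 : a' <= t * (a + d * (a' + a)).
  by apply: (le_trans a'w); rewrite ler_wpM2l//; lra.
have h3 : t * (d * (a' + a)) <= d * (a' + a).
  by rewrite -[leRHS]mul1r ler_wpM2r ?(ltW t1)// mulr_ge0 ?addr_ge0.
by move: h2 h3; rewrite !(mulrDl, mulrDr); lra.
Unshelve. all: by end_near. Qed.

End Convergence.

Theorem theorem3p1 (R : realType) (p L : nat) (lambda1 lambda2 : R)
    (S Thetabar Omegabar Xbar : 'Y[R]_(L, p)) :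
  (1 <= p)%N -> (2 <= L)%N -> 0 <= lambda1 -> 0 <= lambda2 ->
  (forall l, psdmx (S l)) ->
  KKT lambda1 lambda2 S (Thetabar, Omegabar, Xbar) ->
  [/\ KKT lambda1 lambda2 S = [set (Thetabar, Omegabar, Xbar)],
      primal_solutions lambda1 lambda2 S = [set (Thetabar, Omegabar)],
      dual_solutions lambda1 lambda2 S = [set Xbar],
      exists2 kappa : R, 0 <= kappa &
        error_bound lambda1 lambda2 S (Thetabar, Omegabar, Xbar) kappa
    & forall (sigma : nat -> R) (sigma_oo : \bar R)
             (Theta Omega X : nat -> 'Y[R]_(L, p)) (eps : nat -> R),
      (forall k, 0 < sigma k) ->
      {homo sigma : k m / (k <= m)%N >-> k <= m} ->
      (fun k => (sigma k)%:E) @ \oo --> sigma_oo ->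
      rPPA lambda1 lambda2 S sigma Theta Omega X ->
      critA lambda1 lambda2 S sigma Theta Omega X eps ->
      [/\ (fun k => enorm ((Theta k, Omega k) - (Thetabar, Omegabar)))
            @ \oo --> (0 : R),
          (fun k => enorm (X k - Xbar)) @ \oo --> (0 : R)
        & forall (delta : nat -> R) (kappa : R),
          critB lambda1 lambda2 S sigma Theta Omega X delta ->
          0 <= kappa ->
          error_bound lambda1 lambda2 S (Thetabar, Omegabar, Xbar) kappa ->
          (exists kbar : nat, forall k, (kbar <= k)%N ->
             enorm ((Theta k.+1, Omega k.+1, X k.+1)
                    - (Thetabar, Omegabar, Xbar))
             <= rate kappa (sigma k) (delta k)
                * enorm ((Theta k, Omega k, X k)
                         - (Thetabar, Omegabar, Xbar))
             /\ rate kappa (sigma k) (delta k) < 1)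
          /\ (fun k => rate kappa (sigma k) (delta k))
               @ \oo --> rate_limit kappa sigma_oo]].
Proof.
move=> p1 L2 l10 l20 Spsd zbKKT.
have T0 := KKT_T_lagrangian l10 l20 zbKKT.
split.
- apply/seteqP; split=> [[[Th Om] X] zKKT|_ -> //].
  exact: (T_lagrangian_zero_unique T0 (KKT_T_lagrangian l10 l20 zKKT)).
- exact: primal_solutionsE T0.
- exact: dual_solutionsE T0.
- exact: error_bound_exists T0.
move=> sigma sigma_oo Theta Omega X eps s0 snd scvg run A.
have zcvg := rPPA_cvg l10 l20 s0 snd run T0 A; split.
- apply: (squeeze_cvgr _ (@cvg_cst _ 0 _ _ _) zcvg); near=> k.
  rewrite enorm_ge0 /=.
  exact: (enorm_fst ((Theta k, Omega k, X k) - (Thetabar, Omegabar, Xbar))).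
- apply: (squeeze_cvgr _ (@cvg_cst _ 0 _ _ _) zcvg); near=> k.
  rewrite enorm_ge0 /=.
  exact: (enorm_snd ((Theta k, Omega k, X k) - (Thetabar, Omegabar, Xbar))).
move=> delta kappa B kappa0 eb; have [_ dcvg _] := B.
have rcvg := rate_cvg s0 snd scvg kappa0 dcvg; split=> //.
have [N1 _ H1] := rPPA_rate l10 l20 s0 snd run T0 A B kappa0 eb.
(* Early rates may exceed 1, but their limit is below 1. *)
have [N2 _ H2] := cvgr_lt _ rcvg _ (rate_limit_lt1 s0 snd scvg kappa0).
exists (maxn N1 N2) => k; rewrite geq_max => /andP[k1 k2]; split.
  exact: H1.
exact: H2.
Unshelve. all: by end_near. Qed.
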